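(* Let $G=-\Delta-|x|^2\partial_t^2$ be the Grushin operator on $\mathbb{R}^{n+1}$. There exists a function $f\in\mathcal{S}(\mathbb{R}^{n+1})$ such that the solution $u$ of the initial value problem $i\partial_s u(x,t,s)-Gu(x,t,s)=0$ for $s\in\mathbb{R}$, $(x,t)\in\mathbb{R}^{n+1}$, with initial data $u(x,t,0)=f(x,t)$, satisfies $$u(x,t,s)=f(x,t+sn)\qquad\text{for all } s\in\mathbb{R} \text{ and all } (x,t)\in\mathbb{R}^{n+1}.$$
   Context: Points of $\mathbb{R}^{n+1}$ are written $(x,t)$ with $x\in\mathbb{R}^n$, $t\in\mathbb{R}$; $\Delta$ is the Laplacian in $x$ and $|x|=\sqrt{x_1^2+\cdots+x_n^2}$ is the Euclidean norm. $\mathcal{S}(\mathbb{R}^{n+1})$ is the set of all Schwartz class functions on $\mathbb{R}^{n+1}$. $G$ is a positive self-adjoint operator, and for $f\in L^2(\mathbb{R}^{n+1})$ the unique global in time solution of the initial value problem is $u(x,t,s)=e^{-isG}f(x,t)$, defined by the functional calculus for $G$. *)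

(* Defs.v *)
From HB Require Import structures.
From mathcomp Require Import all_boot all_order all_algebra complex.
From mathcomp Require Import all_classical all_reals all_analysis.

Set Implicit Arguments.
Unset Strict Implicit.
Unset Printing Implicit Defensive.

Import Order.TTheory GRing.Theory Num.Theory.
Import numFieldNormedType.Exports.

Local Open Scope classical_set_scope.
Local Open Scope ring_scope.

Definition measure_rV_display : measure_display -> measure_display.
Proof. exact. Qed.

Section measurable_rV.
Context (R : realType) (n : nat).

Let coord (i : 'I_n) (x : 'rV[R]_n) : R := x ord0 i.

Let rV_set0 : g_sigma_preimage coord set0.
Proof. exact: sigma_algebra0. Qed.

Let rV_setC A : g_sigma_preimage coord A -> g_sigma_preimage coord (~` A).
Proof. exact: sigma_algebraC. Qed.

Let rV_bigcup (F : (set 'rV[R]_n)^nat) :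
  (forall i, g_sigma_preimage coord (F i)) ->
  g_sigma_preimage coord (\bigcup_i (F i)).
Proof. exact: sigma_algebra_bigcup. Qed.

HB.instance Definition _ := @isMeasurable.Build
  (measure_rV_display default_measure_display) 'rV[R]_n
  (g_sigma_preimage coord) rV_set0 rV_setC rV_bigcup.

End measurable_rV.

Lemma measurable_coord (R : realType) (n : nat) (i : 'I_n) :
  measurable_fun [set: 'rV[R]_n] (fun x : 'rV[R]_n => x ord0 i).
Proof.
move=> _ Y mY; rewrite setTI; apply: sub_sigma_algebra => /=.
rewrite -bigcup_seq/=; exists i => /=; first by rewrite mem_index_enum.
by exists Y => //; rewrite setTI.
Qed.

Lemma measurable_fun_rVP (R : realType) d (T : measurableType d) (n : nat)
    (f : T -> 'rV[R]_n) :
  measurable_fun [set: T] f <->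
  forall i, measurable_fun [set: T] (fun x => f x ord0 i).
Proof.
split=> [mf i|mf].
  exact: (measurableT_comp (@measurable_coord R n i) mf).
pose h i := (fun x => f x ord0 i).
suff mS : g_sigma_preimage h `<=` measurable.
  move=> _ A mA; rewrite setTI.
  have := @g_sigma_preimage_comp _ R n 'rV[R]_n
    (fun i (x : 'rV[R]_n) => x ord0 i) _ f.
  rewrite -/h => E; apply: mS; rewrite [g_sigma_preimage _]E.
  by exists A => //; rewrite setTI.
apply: smallest_sub; first exact: sigma_algebra_measurable.
rewrite -bigcup_seq/=; apply: bigcup_sub => i _.
by move=> A [B mB <-]; exact: mf.
Qed.

Section lebesgue_cons.
Context (R : realType) (n : nat)
  (m : {sigma_finite_measure set 'rV[R]_n -> \bar R}).
Local Open Scope ereal_scope.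

Let cons_rV (p : R * 'rV[R]_n) : 'rV[R]_n.+1 :=
  \row_i if unlift ord0 i is Some j then p.2 ord0 j else p.1.

Let uncons_rV (x : 'rV[R]_n.+1) : R * 'rV[R]_n :=
  (x ord0 ord0, \row_j x ord0 (lift ord0 j)).

Let cons_rVK : cancel cons_rV uncons_rV.
Proof.
case=> t y; rewrite /uncons_rV /cons_rV /= mxE unlift_none; congr pair.
by apply/rowP => j; rewrite !mxE liftK.
Qed.

Let measurable_cons_rV : measurable_fun [set: R * 'rV[R]_n] cons_rV.
Proof.
apply/measurable_fun_rVP => i; rewrite /cons_rV.
under eq_fun do rewrite mxE.
case: unliftP => [j _|_]; last exact: measurable_fst.
exact: (measurableT_comp (measurable_coord j) measurable_snd).
Qed.

Let measurable_uncons_rV : measurable_fun [set: 'rV[R]_n.+1] uncons_rV.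
Proof.
apply/measurable_fun_pairP; split; first exact: measurable_coord.
apply/measurable_fun_rVP => i /=.
by under eq_fun do rewrite mxE; exact: measurable_coord.
Qed.

Definition lebesgue_cons : set 'rV[R]_n.+1 -> \bar R :=
  pushforward (@lebesgue_measure R \x m) cons_rV.

Let lebesgue_cons0 : lebesgue_cons set0 = 0.
Proof. by rewrite /lebesgue_cons /pushforward preimage_set0 measure0. Qed.

Let lebesgue_cons_ge0 A : 0 <= lebesgue_cons A.
Proof. exact: measure_ge0. Qed.

Let lebesgue_cons_sigma_additive : semi_sigma_additive lebesgue_cons.
Proof.
move=> F mF tF mUF; rewrite /lebesgue_cons /pushforward preimage_bigcup.
apply: measure_semi_sigma_additive.
- by move=> k; rewrite -[X in measurable X]setTI; exact: measurable_cons_rV.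
- apply/trivIsetP => /= i j _ _ ij; rewrite -preimage_setI.
  by move/trivIsetP : tF => /(_ _ _ _ _ ij) ->//; rewrite preimage_set0.
- by rewrite -preimage_bigcup -[X in measurable X]setTI;
    exact: measurable_cons_rV.
Qed.

HB.instance Definition _ := isMeasure.Build _ _ _ lebesgue_cons
  lebesgue_cons0 lebesgue_cons_ge0 lebesgue_cons_sigma_additive.

Let lebesgue_cons_sigma_finite : sigma_finite setT lebesgue_cons.
Proof.
have /sigma_finiteP[F [TF ndF Foo]] := sigma_finiteT (@lebesgue_measure R).
have /sigma_finiteP[G [TG ndG Goo]] := sigma_finiteT m.
exists (fun k => uncons_rV @^-1` (F k `*` G k)).
  rewrite -preimage_bigcup (_ : \bigcup_k _ = setT) ?preimage_setT//.
  apply/seteqP; split => // -[t y] _.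
  have [i _ Fit] : (\bigcup_i F i) t by rewrite -TF.
  have [j _ Gjy] : (\bigcup_j G j) y by rewrite -TG.
  exists (maxn i j) => //; split.
    by move: t Fit; exact/subsetPset/ndF/leq_maxl.
  by move: y Gjy; exact/subsetPset/ndG/leq_maxr.
move=> k; have [mF Fk] := Foo k; have [mG Gk] := Goo k.
have mFG : measurable (F k `*` G k) by exact: measurableX.
split.
  by rewrite -[X in measurable X]setTI; exact: measurable_uncons_rV.
rewrite /lebesgue_cons /pushforward -comp_preimage.
rewrite (_ : uncons_rV \o cons_rV = id); last exact/funext.
by rewrite preimage_id product_measure1E// lte_mul_pinfty// ge0_fin_numE.
Qed.

HB.instance Definition _ := @Measure_isSigmaFinite.Build _ _ _ lebesgue_cons
  lebesgue_cons_sigma_finite.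

End lebesgue_cons.

Fixpoint lebesgue_rV (R : realType) (n : nat) :
    {sigma_finite_measure set 'rV[R]_n -> \bar R} :=
  match n with
  | 0 => [the {sigma_finite_measure set 'rV[R]_0 -> \bar R} of
           \d_(0 : 'rV[R]_0)]
  | n'.+1 => [the {sigma_finite_measure set 'rV[R]_n'.+1 -> \bar R} of
           lebesgue_cons (lebesgue_rV R n')]
  end.

Section complex_valued.
Context (R : realType) (T : Type).
Implicit Types f : T -> R[i].

Definition cRe f : T -> R := fun z => complex.Re (f z).
Definition cIm f : T -> R := fun z => complex.Im (f z).

Definition sqmod f : T -> R := fun z => cRe f z ^+ 2 + cIm f z ^+ 2.

End complex_valued.

(* Points of R^(n+1) are pairs (x, t). *)
Notation xtspace R n := ('rV[R]_n * R)%type.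

Section calculus.
Context (R : realType) (n : nat).
Implicit Types (f : xtspace R n -> R[i]) (z : xtspace R n).

(* [Some j] stands for the variable x_j and [None] for the variable t. *)
Definition axis (d : option 'I_n) : xtspace R n :=
  if d is Some j then (delta_mx ord0 j, 0) else (0, 1).

Definition partial (d : option 'I_n) f : xtspace R n -> R[i] := fun z =>
  ('D_(axis d) (cRe f) z +i* 'D_(axis d) (cIm f) z)%C.

Definition iter_partial (ds : seq (option 'I_n)) f : xtspace R n -> R[i] :=
  foldr partial f ds.

Definition smooth f := forall ds z,
  differentiable (cRe (iter_partial ds f)) z /\
  differentiable (cIm (iter_partial ds f)) z.

(* `|z| is the maximum norm of R^(n+1); as all norms are equivalent it defines
   the same class as the Euclidean one. *)
Definition schwartz f := smooth f /\
  forall ds (N : nat), exists C : R, forall z,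
    (1 + `|z|) ^+ N * Num.sqrt (sqmod (iter_partial ds f) z) <= C.

Definition enorm (x : 'rV[R]_n) : R := Num.sqrt (\sum_(j < n) x ord0 j ^+ 2).

Definition grushin f : xtspace R n -> R[i] := fun z =>
  - (\sum_(j < n) partial (Some j) (partial (Some j) f) z)
  - ((enorm z.1 ^+ 2)%:C)%C * partial None (partial None f) z.

End calculus.

Section L2.
Context (R : realType) (n : nat).
Implicit Types f g : xtspace R n -> R[i].

Definition lebesgue_xt :
    {measure set ('rV[R]_n * measurableTypeR R)%type -> \bar R} :=
  [the {measure set _ -> \bar R} of (lebesgue_rV R n \x @lebesgue_measure R)%E].

Definition sqnorm f : \bar R := (\int[lebesgue_xt]_z (sqmod f z)%:E)%E.

Definition L2 f :=
  [/\ measurable_fun [set: 'rV[R]_n * measurableTypeR R] (cRe f),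
      measurable_fun [set: 'rV[R]_n * measurableTypeR R] (cIm f) &
      (sqnorm f < +oo)%E].

Definition inner f g : R[i] :=
  let h := fun z => f z * conjc (g z) in
  (Rintegral lebesgue_xt setT (cRe h) +i*
   Rintegral lebesgue_xt setT (cIm h))%C.

End L2.

(* The closure in L^2 of the differential operator on Schwartz functions, given
   by its graph. Elements of L^2 are functions and an operator relates functions
   up to almost everywhere equality. -Delta - |x|^2 d_t^2 is essentially
   self-adjoint on Schwartz functions, so this is its only self-adjoint
   extension. *)
Definition grushin_operator (R : realType) (n : nat)
    (f h : xtspace R n -> R[i]) : Prop :=
  [/\ L2 f, L2 h &
    exists phi : nat -> xtspace R n -> R[i], [/\ forall k, schwartz (phi k),
      (fun k => sqnorm (fun z => phi k z - f z)) @ \oo --> 0%E &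
      (fun k => sqnorm (fun z => grushin (phi k) z - h z)) @ \oo --> 0%E]].

Section functional_calculus.
Context (R : realType) (n : nat).
Implicit Types (E : set R -> (xtspace R n -> R[i]) -> (xtspace R n -> R[i]))
  (f g h : xtspace R n -> R[i]) (B C : set R) (phi : R -> R[i]).

(* B |-> <E(B) f, f> = ||E(B) f||^2 *)
Definition spectral_distribution E f : set R -> \bar R :=
  fun B => sqnorm (E B f).

(* Orthogonal projections are the self-adjoint idempotents; linearity of E(B)
   (almost everywhere) follows from self-adjointness. *)
Definition projection_valued_measure E :=
  [/\ forall B f, measurable B -> L2 f -> L2 (E B f),
      forall B f g, measurable B -> L2 f -> L2 g ->
        inner (E B f) g = inner f (E B g),
      forall B C f, measurable B -> measurable C -> L2 f ->
        E B (E C f) = E (B `&` C) f %[ae (@lebesgue_xt R n)],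
      forall f, L2 f ->
        E set0 f = (fun=> 0) %[ae (@lebesgue_xt R n)] /\
        E setT f = f %[ae (@lebesgue_xt R n)] &
      forall f, L2 f -> semi_sigma_additive (spectral_distribution E f)].

Definition cintegral (m : set R -> \bar R) phi : R[i] :=
  (fine (\int[m]_l (cRe phi l)%:E)%E +i* fine (\int[m]_l (cIm phi l)%:E)%E)%C.

(* The integral of phi against the complex measure B |-> <E(B) f, g>, written
   with positive measures by polarization:
   4 <E(B) f, g> = \sum_(k < 4) i^k <E(B) (f + i^k g), f + i^k g>. *)
Definition spectral_form E phi f g : R[i] :=
  4%:R^-1 * \sum_(k < 4) (0 +i* 1)%C ^+ k *
    cintegral (spectral_distribution E (fun z => f z + (0 +i* 1)%C ^+ k * g z))
      phi.

Definition spectral_domain E phi f :=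
  L2 f /\ (\int[spectral_distribution E f]_l (sqmod phi l)%:E < +oo)%E.

(* h = phi(A) f, for phi(A) the integral of phi with respect to E. *)
Definition spectral_integral E phi f h :=
  [/\ spectral_domain E phi f, L2 h &
      forall g, spectral_domain E phi g -> inner h g = spectral_form E phi f g].

(* The operator A (given by its graph) is the integral of the identity function
   with respect to E. By the spectral theorem such an E exists exactly when A is
   self-adjoint, and the values E B f (B measurable, f in L^2) are then unique
   up to almost everywhere equality. *)
Definition spectral_measure_of
    (A : (xtspace R n -> R[i]) -> (xtspace R n -> R[i]) -> Prop) E :=
  projection_valued_measure E /\
  forall f h, A f h <-> spectral_integral E (fun l => (l%:C)%C) f h.

(* l |-> exp(- i s l) *)
Definition expNi (s : R) : R -> R[i] :=
  fun l => (cos (s * l) -i* sin (s * l))%C.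

(* h = exp(- i s A) f; quantifying over E is harmless as A determines it. *)
Definition exp_group A (s : R) f h :=
  forall E, spectral_measure_of A E -> spectral_integral E (expNi s) f h.

End functional_calculus.

(* [u s] is the continuous representative of the class exp(- i s G) f of L^2,
   and it solves the equation pointwise. *)
Definition grushin_solution (R : realType) (n : nat) (f : xtspace R n -> R[i])
    (u : R -> xtspace R n -> R[i]) : Prop :=
  [/\ forall s, smooth (u s),
      forall s, exp_group (@grushin_operator R n) s f (u s),
      u 0 = f &
      forall s z,
        [/\ derivable (fun r => cRe (u r) z) s 1,
            derivable (fun r => cIm (u r) z) s 1 &
            (0 +i* 1)%C * (derive1 (fun r => cRe (u r) z) s +i*
                           derive1 (fun r => cIm (u r) z) s)%C
              - grushin (u s) z = 0]].

(* Main.v *)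
(* Let [w = 1 + |x|^2 / 2 + i t] and [f = exp (- sqrt w)], with the principal
   square root. Since [|grad_x w|^2 = |x|^2 = - |x|^2 (d_t w)^2], the second
   derivatives of [exp (- sqrt w)] cancel in [G f], which leaves
   [G f = - n f'(w) = i n d_t f]: the translates [u_s] of [f] in [t] solve the
   equation. As [Re (sqrt w)] is at least [sqrt (|w| / 2)], [f] is a Schwartz
   function.

   To identify [u_s] with [exp (- i s A) f] for a given spectral measure [E] of
   [A], cut the spectrum into cells [B_j = `[l_j, l_j + d[]. Polarization gives
   [|<(A - l_j) u, E(B_j) g>| <= d (|E(B_j) u|^2 + |E(B_j) g|^2)], so that the
   derivative in [r] of [\sum_j exp (- i (1 - r) s l_j) <u_(r s), E(B_j) g>] is
   [O(d)]. Letting [d] tend to [0] yields [<u_s, g> = <exp (- i s A) f, g>]. *)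

Require Import Defs.
From HB Require Import structures.
From mathcomp Require Import all_boot all_order all_algebra complex.
From mathcomp Require Import all_classical all_reals all_analysis.
From mathcomp Require Import measurable_realfun ring lra.

Set Implicit Arguments.
Unset Strict Implicit.
Unset Printing Implicit Defensive.

Import Order.TTheory GRing.Theory Num.Theory.
Import numFieldNormedType.Exports.

Local Open Scope classical_set_scope.
Local Open Scope ring_scope.

(** * Square-integrable functions *)

(** Every holomorphic F(w) in place of exp (- sqrt w) solves the same equation; the choice of F is
    dictated by decay. In t, exp (- w) has constant modulus, whereas the square root turns a large
    Im w into decay. The summand 1 in w keeps it away from the branch point 0.

    Derivatives of f are not estimated one by one: they stay in a class of expressions closed under
    partial derivatives, and bounds are proved by induction on the expression.

    On the spectral side, E enters through the finite positive measures B |-> |E(B) f|^2 and through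
    inner products, and u is differentiated only weakly, against a fixed vector. Cutting the
    spectrum replaces the operator family exp (- i (1 - r) s A) by finitely many numerical phases,
    so that the mean value theorem for real functions of r applies. The vectors E(B_j) g have a
    second purpose: B_j being bounded, they lie in the domain of A, which is where the spectral
    integral defining A u may be tested. *)

Section real_L2.
Context d (T : measurableType d) (R : realType).
Variable mu : {measure set T -> \bar R}.
Implicit Types a b : T -> R.

Definition rL2 a :=
  measurable_fun setT a /\ (\int[mu]_z (a z ^+ 2)%:E < +oo)%E.

Lemma rL2_integrable_sqr a : rL2 a -> mu.-integrable setT (fun z => (a z ^+ 2)%:E).
Proof.
move=> [ma fa]; apply/integrableP; split.
  by apply/measurable_EFinP; exact: measurable_funX.
by under eq_integral do rewrite abse_EFin ger0_norm ?sqr_ge0//.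
Qed.

Lemma rL2_integrableM a b : rL2 a -> rL2 b ->
  mu.-integrable setT (EFin \o (fun z => a z * b z)).
Proof.
move=> La Lb; have [ma _] := La; have [mb _] := Lb.
apply: (@le_integrable _ _ _ mu setT _ _
  (fun z => (a z ^+ 2)%:E + (b z ^+ 2)%:E)%E) => //.
- by apply/measurable_EFinP; exact: measurable_funM.
- move=> z _ /=; rewrite lee_fin [leRHS]ger0_norm ?addr_ge0 ?sqr_ge0//.
  rewrite normrM -(real_normK (num_real (a z))) -(real_normK (num_real (b z))).
  have := sqr_ge0 (`|a z| - `|b z|); have := normr_ge0 (a z); have := normr_ge0 (b z).
  nra.
- by apply: integrableD => //; exact: rL2_integrable_sqr.
Qed.

Lemma rL2D a b : rL2 a -> rL2 b -> rL2 (fun z => a z + b z).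
Proof.
move=> La Lb; have [ma _] := La; have [mb _] := Lb.
split; first exact: measurable_funD.
have : mu.-integrable setT
    (fun z => 2%:E * (a z ^+ 2)%:E + 2%:E * (b z ^+ 2)%:E)%E.
  by apply: integrableD => //; apply: integrableZl => //; exact: rL2_integrable_sqr.
move/integrable_lty => /(_ measurableT).
apply: le_lt_trans; apply: ge0_le_integral => //.
- by move=> z _; rewrite lee_fin sqr_ge0.
- by apply/measurable_EFinP; apply: measurable_funX; exact: measurable_funD.
- by apply/measurable_EFinP; apply: measurable_funD; apply: measurable_funM => //;
    exact: measurable_funX.
- move=> z _; rewrite -!EFinM -EFinD lee_fin.
  by have := sqr_ge0 (a z - b z); nra.
Qed.

Lemma rL2Z k a : rL2 a -> rL2 (fun z => k * a z).
Proof.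
move=> La; have [ma _] := La; split; first exact: measurable_funM.
have : mu.-integrable setT (fun z => (k ^+ 2)%:E * (a z ^+ 2)%:E)%E.
  by apply: integrableZl => //; exact: rL2_integrable_sqr.
move/integrable_lty => /(_ measurableT); apply: le_lt_trans.
by under eq_integral do rewrite exprMn EFinM.
Qed.

Lemma rL2_le a b : measurable_fun setT a -> (forall z, `|a z| <= b z) ->
  rL2 b -> rL2 a.
Proof.
move=> ma ab [mb fb]; split=> //; apply: le_lt_trans fb.
apply: ge0_le_integral => //.
- by move=> z _; rewrite lee_fin sqr_ge0.
- by apply/measurable_EFinP; exact: measurable_funX.
- by apply/measurable_EFinP; exact: measurable_funX.
- move=> z _; rewrite lee_fin -real_normK ?num_real//.
  by rewrite ler_pXn2r ?nnegrE// (le_trans _ (ab z)).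
Qed.

Definition dot a b : R := Rintegral mu setT (fun z => a z * b z).

Lemma dotC a b : dot a b = dot b a.
Proof. by apply: eq_Rintegral => z _; rewrite mulrC. Qed.

Lemma dotDl a b c : rL2 a -> rL2 b -> rL2 c ->
  dot (fun z => a z + b z) c = dot a c + dot b c.
Proof.
move=> La Lb Lc; rewrite /dot -RintegralD//; try exact: rL2_integrableM.
by apply: eq_Rintegral => z _; rewrite mulrDl.
Qed.

Lemma dotZl k a c : rL2 a -> rL2 c -> dot (fun z => k * a z) c = k * dot a c.
Proof.
move=> La Lc; rewrite /dot -RintegralZl//; try exact: rL2_integrableM.
by apply: eq_Rintegral => z _; rewrite mulrA.
Qed.

End real_L2.

(** * The sesquilinear inner product of complex L^2 functions *)

Section L2_theory.
Context (R : realType) (n : nat).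
Local Notation mZ := ('rV[R]_n * measurableTypeR R)%type.
Local Notation mu := (lebesgue_xt R n).
Local Notation rL2 := (@rL2 _ mZ R mu).
Local Notation dot := (@dot _ mZ R mu).
Implicit Types f g h : xtspace R n -> R[i].

Lemma L2P f : L2 f <-> rL2 (cRe f) /\ rL2 (cIm f).
Proof.
rewrite /L2 /sqnorm /sqmod; split.
  move=> [mr mi fin]; split; split=> //; apply: le_lt_trans fin;
  apply: ge0_le_integral => //;
    try (by move=> z _; rewrite lee_fin ?sqr_ge0);
    try (by apply/measurable_EFinP; try apply: measurable_funD => //;
      exact: measurable_funX).
  - by move=> z _; rewrite lee_fin lerDl sqr_ge0.
  - by move=> z _; rewrite lee_fin lerDr sqr_ge0.
move=> [Lr Li]; have [mr _] := Lr; have [mi _] := Li; split => //.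
have : mu.-integrable setT (fun z => ((cRe f z ^+ 2)%:E + (cIm f z ^+ 2)%:E)%E).
  by apply: integrableD => //; exact: rL2_integrable_sqr.
by move/integrable_lty => /(_ measurableT).
Qed.

Lemma L2D f g : L2 f -> L2 g -> L2 (fun z => f z + g z).
Proof.
move=> /L2P[fr fi] /L2P[gr gi]; apply/L2P; split.
- rewrite (_ : cRe _ = fun z => cRe f z + cRe g z); first exact: rL2D.
  by apply/funext => z; rewrite /cRe; case: (f z) (g z) => [? ?] [].
- rewrite (_ : cIm _ = fun z => cIm f z + cIm g z); first exact: rL2D.
  by apply/funext => z; rewrite /cIm; case: (f z) (g z) => [? ?] [].
Qed.

Lemma cReM (c : R[i]) f : cRe (fun z => c * f z) =
  fun z => complex.Re c * cRe f z + (- complex.Im c) * cIm f z.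
Proof.
by apply/funext => z; rewrite /cRe /cIm; case: c (f z) => [a b] [e k] /=; rewrite mulNr.
Qed.

Lemma cImM (c : R[i]) f : cIm (fun z => c * f z) =
  fun z => complex.Re c * cIm f z + complex.Im c * cRe f z.
Proof.
by apply/funext => z; rewrite /cRe /cIm; case: c (f z) => [a b] [e k] /=.
Qed.

Lemma L2Z c f : L2 f -> L2 (fun z => c * f z).
Proof.
move=> /L2P[fr fi]; apply/L2P; rewrite cReM cImM.
by split; apply: rL2D; exact: rL2Z.
Qed.

Lemma innerE f g : L2 f -> L2 g ->
  inner f g = ((dot (cRe f) (cRe g) + dot (cIm f) (cIm g))
    +i* (dot (cIm f) (cRe g) - dot (cRe f) (cIm g)))%C.
Proof.
move=> /L2P[fr fi] /L2P[gr gi]; rewrite /inner; congr Complex.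
- rewrite /dot -RintegralD//; try exact: rL2_integrableM.
  apply: eq_Rintegral => z _; rewrite /cRe /cIm.
  by case: (f z) (g z) => [a b] [c e] /=; rewrite mulrN opprK.
- rewrite /dot -RintegralB//; try exact: rL2_integrableM.
  apply: eq_Rintegral => z _; rewrite /cRe /cIm.
  by case: (f z) (g z) => [a b] [c e] /=; rewrite mulrN addrC.
Qed.

Lemma innerC f g : L2 f -> L2 g -> inner f g = conjc (inner g f).
Proof.
move=> Lf Lg; rewrite !innerE//=; congr Complex.
- by rewrite dotC (dotC mu (cIm f)).
- by rewrite opprB dotC (dotC mu (cRe f)).
Qed.

Lemma innerDl f g h : L2 f -> L2 g -> L2 h ->
  inner (fun z => f z + g z) h = inner f h + inner g h.
Proof.
move=> Lf Lg Lh; rewrite !innerE//; last exact: L2D.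
have [fr fi] := (L2P f).1 Lf; have [gr gi] := (L2P g).1 Lg.
have [hr hi] := (L2P h).1 Lh.
rewrite (_ : cRe _ = fun z => cRe f z + cRe g z); last first.
  by apply/funext => z; rewrite /cRe; case: (f z) (g z) => [? ?] [].
rewrite (_ : cIm (fun z => f z + g z) = fun z => cIm f z + cIm g z); last first.
  by apply/funext => z; rewrite /cIm; case: (f z) (g z) => [? ?] [].
rewrite !dotDl//; congr Complex; ring.
Qed.

Lemma innerZl c f g : L2 f -> L2 g -> inner (fun z => c * f z) g = c * inner f g.
Proof.
move=> Lf Lg; rewrite !innerE//; last exact: L2Z.
have [fr fi] := (L2P f).1 Lf; have [gr gi] := (L2P g).1 Lg.
rewrite cReM cImM !dotDl//; try exact: rL2Z.
by rewrite !dotZl//; case: c => a b /=; congr Complex; ring.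
Qed.

Lemma conjcD (x y : R[i]) : conjc (x + y) = conjc x + conjc y.
Proof. by case: x y => [a b] [c e] /=; rewrite opprD. Qed.

Lemma conjcM (x y : R[i]) : conjc (x * y) = conjc x * conjc y.
Proof. by case: x y => [a b] [c e] /=; congr Complex; ring. Qed.

Lemma innerDr f g h : L2 f -> L2 g -> L2 h ->
  inner h (fun z => f z + g z) = inner h f + inner h g.
Proof.
move=> Lf Lg Lh; rewrite innerC//; last exact: L2D.
by rewrite innerDl// conjcD -!innerC.
Qed.

Lemma innerZr c f g : L2 f -> L2 g ->
  inner g (fun z => c * f z) = conjc c * inner g f.
Proof.
move=> Lf Lg; rewrite innerC//; last exact: L2Z.
by rewrite innerZl// conjcM -innerC.
Qed.

(** The laws of a projection-valued measure hold almost everywhere; this turns them into equalities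
    of inner products. *)
Lemma inner_aer f g h : L2 f -> L2 g -> L2 h ->
  (g = h %[ae mu]) -> inner f g = inner f h.
Proof.
move=> Lf Lg Lh gh; rewrite !innerE//.
have [fr fi] := (L2P f).1 Lf; have [gr gi] := (L2P g).1 Lg.
have [hr hi] := (L2P h).1 Lh.
(* [F] stands for [cRe] or [cIm], so that the real pairings are treated alike. *)
have aux (F : (xtspace R n -> R[i]) -> xtspace R n -> R) a :
    (forall k k' z, k z = k' z -> F k z = F k' z) ->
    measurable_fun (setT : set mZ) a ->
    measurable_fun (setT : set mZ) (F g) -> measurable_fun (setT : set mZ) (F h) ->
    dot a (F g) = dot a (F h).
  move=> FE ma mg mh; rewrite /dot /Rintegral; congr fine.
  apply: (@ae_eq_integral _ _ _ mu) => //.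
  - by apply/measurable_EFinP; exact: measurable_funM.
  - by apply/measurable_EFinP; exact: measurable_funM.
  - case: gh => N [mN N0 sN]; exists N; split => //.
    by apply: subset_trans sN => z /= + ghz; apply => _; rewrite (FE g h z (ghz I)).
have cr (k k' : xtspace R n -> R[i]) z : k z = k' z -> cRe k z = cRe k' z by rewrite /cRe => ->.
have ci (k k' : xtspace R n -> R[i]) z : k z = k' z -> cIm k z = cIm k' z by rewrite /cIm => ->.
move: fr fi gr gi hr hi => [? _] [? _] [? _] [? _] [? _] [? _].
by rewrite !(aux (@cRe R _) _ cr)// !(aux (@cIm R _) _ ci).
Qed.

Lemma inner_self f : L2 f -> ((complex.Re (inner f f))%:E = sqnorm f)%E.
Proof.
move=> Lf; rewrite innerE//=; have [fr fi] := (L2P f).1 Lf.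
rewrite /dot -RintegralD//; try exact: rL2_integrableM.
rewrite /Rintegral /sqnorm /sqmod fineK; last first.
  have : mu.-integrable setT
      (fun z => ((cRe f z * cRe f z)%:E + (cIm f z * cIm f z)%:E)%E).
    by apply: integrableD => //; exact: rL2_integrableM.
  exact: integrable_fin_num.
by apply: eq_integral => z _; rewrite !expr2.
Qed.

End L2_theory.

(** * Spectral measures *)

Section riemann_sum.
Context (R : realType).
Implicit Types (l : R) (c : R -> R).

(** A single parameter refines the mesh to 1 / (M + 1) and widens the window to [- (M + 1), M + 1[;
    hence the 2 (M + 1)^2 cells. *)
Definition node (M j : nat) : R := j%:R / M.+1%:R - M.+1%:R.

Definition cell (M j : nat) : set R := `[node M j, node M j.+1[%classic.

Definition ncells (M : nat) : nat := (2 * M.+1 * M.+1)%N.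

Lemma measurable_cell M j : measurable (cell M j).
Proof. exact: measurable_itv. Qed.

Lemma node_step M j : node M j.+1 = node M j + M.+1%:R^-1.
Proof. by rewrite /node -natr1; field. Qed.

Lemma cellE M j l : cell M j l <->
  j%:R <= (l + M.+1%:R) * M.+1%:R < j.+1%:R.
Proof.
rewrite /cell /= in_itv /= /node.
by rewrite lerBlDr ltrBrDr ler_pdivrMr ?ltr0Sn// ltr_pdivlMr ?ltr0Sn//.
Qed.

Lemma cell_inj M j k l : cell M j l -> cell M k l -> j = k.
Proof.
move=> /cellE/andP[a b] /cellE/andP[c e]; apply/eqP; rewrite eqn_leq.
by rewrite -ltnS -(ltnS k) -!(ltr_nat R) (le_lt_trans a e) (le_lt_trans c b).
Qed.

Lemma cell_ex M l : - M.+1%:R <= l < M.+1%:R ->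
  exists j : 'I_(ncells M), cell M j l.
Proof.
move=> /andP[a b].
have lN : 0 <= l + M.+1%:R by rewrite -lerBlDr sub0r.
have y0 : 0 <= (l + M.+1%:R) * M.+1%:R.
  exact: mulr_ge0.
have /andP[c e] := truncn_itv y0.
have jN : (Num.truncn ((l + M.+1%:R) * M.+1%:R) < ncells M)%N.
  rewrite -(ltr_nat R) (le_lt_trans c)// /ncells !natrM ltr_pM2r ?ltr0Sn//.
  by rewrite mulr_natl mulr2n ltrD2r.
by exists (Ordinal jN); apply/cellE => /=; rewrite c e.
Qed.

Lemma cell_near M j l : cell M j l -> `|l - node M j| <= M.+1%:R^-1.
Proof.
rewrite /cell /= in_itv /= node_step => /andP[a b].
by rewrite ger0_norm ?subr_ge0// lerBlDl ltW.
Qed.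

Definition step (c : R -> R) M (l : R) : R :=
  \sum_(j < ncells M) c (node M j) * \1_(cell M j) l.

Lemma step_in c M (j : 'I_(ncells M)) l : cell M j l -> step c M l = c (node M j).
Proof.
move=> jl; rewrite /step (bigD1 j)//= big1 ?addr0.
  by rewrite indicE mem_set// mulr1.
move=> k kj; rewrite indicE memNset ?mulr0// => kl.
by move/eqP : kj; apply; apply/val_inj; exact: cell_inj kl jl.
Qed.

Lemma step_out c M l : (forall j : 'I_(ncells M), ~ cell M j l) -> step c M l = 0.
Proof.
by move=> H; rewrite /step big1// => j _; rewrite indicE memNset ?mulr0//; exact: H.
Qed.

Lemma step_bound c K M l : 0 <= K -> (forall x, `|c x| <= K) -> `|step c M l| <= K.
Proof.
move=> K0 cK; have [[j jl]|/forallNP H] := pselect (exists j : 'I_(ncells M), cell M j l).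
  by rewrite (step_in c jl).
by rewrite step_out// normr0.
Qed.

(** A fixed l is eventually inside the window, and then its cell has a left node within 1 / (M + 1)
    of it. *)
Lemma step_cvg c l : continuous c -> step c ^~ l @ \oo --> c l.
Proof.
move=> cc; apply/cvgrPdist_le => e e0.
have /cvgrPdist_le/(_ e e0) := cc l.
move=> [d /= d0 dd].
have lM : \forall M \near \oo, `|l| < M.+1%:R.
  near=> M; rewrite (@lt_le_trans _ _ (M%:R))// ?ler_nat//.
  by near: M; exact: nbhs_infty_gtr.
have dM : \forall M \near \oo, (M.+1%:R^-1 : R) < d.
  near=> M; rewrite invf_plt ?posrE//.
  rewrite (@lt_le_trans _ _ (M%:R))// ?ler_nat//.
  by near: M; exact: nbhs_infty_gtr.
near=> M.
have /cell_ex[j jl] : - M.+1%:R <= l < M.+1%:R.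
  have : `|l| < M.+1%:R by near: M.
  by rewrite ltr_norml => /andP[/ltW -> ->].
rewrite (step_in c jl); apply: dd => /=.
by rewrite (le_lt_trans (cell_near jl))//; near: M.
Unshelve. all: end_near. Qed.

Lemma measurable_step c M : measurable_fun setT (step c M).
Proof.
apply: measurable_sum => j; apply: measurable_funM => //.
by apply: measurable_indic; exact: measurable_cell.
Qed.

Lemma integral_step (m : {finite_measure set R -> \bar R}) c M :
  Rintegral m setT (step c M) =
  \sum_(j < ncells M) c (node M j) * fine (m (cell M j)).
Proof.
have mfin A : measurable A -> m A \is a fin_num by move=> mA; exact: fin_num_measure.
have int1 (j : 'I_(ncells M)) : m.-integrable setT (EFin \o \1_(cell M j)).
  exact: integrable_indic (measurable_cell M j).
rewrite /Rintegral /step.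
under eq_integral do rewrite -sumEFin.
rewrite integral_sum//; last first.
  move=> j; under eq_fun do rewrite EFinM.
  by apply: integrableZl => //; exact: int1.
rewrite (_ : (\sum_(j < ncells M) _)%E =
    (\sum_(j < ncells M) (c (node M j) * fine (m (cell M j)))%:E)%E).
  by rewrite sumEFin.
apply: eq_bigr => j _.
under eq_integral do rewrite EFinM.
rewrite integralZl//; last exact: int1.
rewrite EFinM fineK ?mfin//; last exact: measurable_cell.
by rewrite integral_indic ?setIT//; exact: measurable_cell.
Qed.

(** Dominated convergence for the step functions: the constant K is an integrable majorant because m
    is finite, so the mass outside the window is harmless. *)
Lemma riemann_sum_cvg (m : {finite_measure set R -> \bar R}) c K :
  continuous c -> (forall x, `|c x| <= K) ->
  \sum_(j < ncells M) c (node M j) * fine (m (cell M j)) @[M --> \oo]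
    --> Rintegral m setT c.
Proof.
move=> cc cK; have K0 : 0 <= K by rewrite (le_trans _ (cK 0)).
have mc : measurable_fun setT c by exact: continuous_measurable_fun.
under eq_fun do rewrite -integral_step.
have [||||ic _] := @dominated_convergence _ _ _ m setT measurableT
  (fun M l => (step c M l)%:E) (fun l => (c l)%:E) (fun=> K%:E)
  (fun M => (measurable_EFinP _ _).2 (measurable_step c M)).
- exact/measurable_EFinP.
- by apply/aeW => l _; apply: cvg_EFin; [exact: nearW|exact: step_cvg].
- exact: finite_measure_integrable_cst.
- by apply/aeW => l M _; rewrite lee_fin; exact: step_bound.
move=> H; apply: fine_cvg; rewrite /Rintegral fineK//.
exact: integrable_fin_num.
Qed.

End riemann_sum.

(** * Quadratic forms of a projection-valued measure *)

Section pvm.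
Context (R : realType) (n : nat).
Variable E : set R -> (xtspace R n -> R[i]) -> (xtspace R n -> R[i]).
Hypothesis pv : projection_valued_measure E.
Implicit Types (f g : xtspace R n -> R[i]) (B C : set R).

Lemma pvm_L2 B f : measurable B -> L2 f -> L2 (E B f).
Proof. by case: pv => H *; exact: H. Qed.

Lemma pvm_sym B f g : measurable B -> L2 f -> L2 g ->
  inner (E B f) g = inner f (E B g).
Proof. by case: pv => _ H *; exact: H. Qed.

Lemma pvm_setI B C f g : measurable B -> measurable C -> L2 f -> L2 g ->
  inner f (E B (E C g)) = inner f (E (B `&` C) g).
Proof.
case: pv => _ _ H _ _ mB mC Lf Lg; apply: inner_aer; last exact: H.
- exact: Lf.
- by do 2 apply: pvm_L2 => //.
- by apply: pvm_L2 => //; exact: measurableI.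
Qed.

Lemma pvm_setT f g : L2 f -> L2 g -> inner f (E setT g) = inner f g.
Proof.
case: pv => _ _ _ H _ Lf Lg; apply: inner_aer => //; last exact: (H g Lg).2.
exact: pvm_L2.
Qed.

Lemma pvm_set0 f g : L2 f -> L2 g -> inner f (E set0 g) = 0.
Proof.
move=> Lf Lg; have [_ _ _ /(_ g Lg)[E0 _] _] := pv.
(* Zero is written as a multiple of [f] so that [innerZr] evaluates the pairing. *)
have Z : (fun=> 0) = (fun z => 0 * f z) :> (xtspace R n -> R[i]).
  by apply/funext => z; rewrite mul0r.
rewrite (inner_aer Lf _ _ E0) ?Z; [|exact: pvm_L2|exact: L2Z].
by rewrite innerZr// [conjc 0]/= oppr0 mul0r.
Qed.

(** Additivity of [E B] in weak form: symmetry moves the projection to the other argument, where the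
    inner product is additive. *)
Lemma pvm_innerDr B f g h : measurable B -> L2 f -> L2 g -> L2 h ->
  inner f (E B (fun z => g z + h z)) = inner f (E B g) + inner f (E B h).
Proof.
move=> mB Lf Lg Lh; rewrite -!pvm_sym ?innerDr//; last exact: L2D.
exact: pvm_L2.
Qed.

Lemma pvm_innerZr B c f g : measurable B -> L2 f -> L2 g ->
  inner f (E B (fun z => c * g z)) = conjc c * inner f (E B g).
Proof.
move=> mB Lf Lg; rewrite -!pvm_sym ?innerZr//; last exact: L2Z.
exact: pvm_L2.
Qed.

Lemma pvm_innerC B f g : measurable B -> L2 f -> L2 g ->
  inner g (E B f) = conjc (inner f (E B g)).
Proof. by move=> mB Lf Lg; rewrite -pvm_sym// innerC//; exact: pvm_L2. Qed.

(** By symmetry and idempotence this is |E(B) f|^2; written as an inner product it can be expanded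
    in f. *)
Definition nsq B f : R := complex.Re (inner f (E B f)).

Lemma sqnorm_pvm B f : measurable B -> L2 f -> sqnorm (E B f) = (nsq B f)%:E.
Proof.
move=> mB Lf; rewrite -inner_self; last exact: pvm_L2.
rewrite pvm_sym//; last exact: pvm_L2.
by rewrite pvm_setI// setIid.
Qed.

Lemma nsq_ge0 B f : measurable B -> L2 f -> 0 <= nsq B f.
Proof.
move=> mB Lf; rewrite -lee_fin -sqnorm_pvm//; apply: integral_ge0 => z _.
by rewrite lee_fin addr_ge0 ?sqr_ge0.
Qed.

Lemma pvm_self B f : measurable B -> L2 f -> inner f (E B f) = ((nsq B f)%:C)%C.
Proof.
move=> mB Lf; rewrite /nsq; have := pvm_innerC mB Lf Lf.
by case: (inner f _) => a b [] ab; congr Complex; lra.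
Qed.

Lemma nsqD B c f g : measurable B -> L2 f -> L2 g ->
  nsq B (fun z => f z + c * g z) =
  nsq B f + (complex.Re c ^+ 2 + complex.Im c ^+ 2) * nsq B g +
  2 * (complex.Re c * complex.Re (inner f (E B g)) +
       complex.Im c * complex.Im (inner f (E B g))).
Proof.
move=> mB Lf Lg; have Lcg := L2Z c Lg.
rewrite {1}/nsq pvm_innerDr//; last exact: L2D.
rewrite !innerDl//; try exact: pvm_L2.
rewrite pvm_innerZr// !innerZl//; try exact: pvm_L2.
rewrite pvm_innerZr// (pvm_innerC mB Lf Lg) !pvm_self//.
by case: c {Lcg} => a b; case: (inner f _) => e k /=; ring.
Qed.

(** As k varies, the cross term runs through the real and imaginary parts of <f, E(B) g> and their
    opposites, which is what polarization inverts. *)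
Lemma nsqP (k : 'I_4) B f g : measurable B -> L2 f -> L2 g ->
  nsq B (fun z => f z + (0 +i* 1)%C ^+ k * g z) =
  nsq B f + nsq B g + 2 *
    match val k with
    | 0 => complex.Re (inner f (E B g))
    | 1 => complex.Im (inner f (E B g))
    | 2 => - complex.Re (inner f (E B g))
    | _ => - complex.Im (inner f (E B g))
    end.
Proof.
move=> mB Lf Lg; rewrite nsqD//; case: k => [[|[|[|[|//]]]] ?] /=.
all: by rewrite !exprS expr0 /=; ring.
Qed.

End pvm.

Section spectral_measure.
Context (R : realType) (n : nat).
Variable E : set R -> (xtspace R n -> R[i]) -> (xtspace R n -> R[i]).
Hypothesis pv : projection_valued_measure E.
Variable f : xtspace R n -> R[i].
Hypothesis Lf : L2 f.

(** Keeping the two proofs in the term lets the measure structures below, which depend on them, be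
    inferred from it. *)
Definition spm (_ : projection_valued_measure E) (_ : L2 f) :=
  spectral_distribution E f.

Let spm0 : spm pv Lf set0 = 0%E.
Proof.
by rewrite /spm /spectral_distribution (sqnorm_pvm pv)// /nsq (pvm_set0 pv).
Qed.

Let spm_ge0 A : (0 <= spm pv Lf A)%E.
Proof.
by apply: integral_ge0 => z _; rewrite lee_fin addr_ge0 ?sqr_ge0.
Qed.

Let spm_semi : semi_sigma_additive (spm pv Lf).
Proof. by have [_ _ _ _ H] := pv; exact: H. Qed.

HB.instance Definition _ := isMeasure.Build _ _ _ (spm pv Lf)
  spm0 spm_ge0 spm_semi.

Let spm_fin : fin_num_fun (spm pv Lf).
Proof. by move=> A mA; rewrite /spm /spectral_distribution (sqnorm_pvm pv). Qed.

HB.instance Definition _ := Measure_isFinite.Build _ _ _ (spm pv Lf) spm_fin.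

End spectral_measure.

(** * First and second moments of finite measures *)

Section moments.
Context (R : realType).
Local Open Scope ereal_scope.

(** A bounded set B contributes at most K^2 m(B), so membership in the domain of A is decided off
    B. *)
Lemma second_moment_split (m : {finite_measure set R -> \bar R}) (B : set R) (K : R) :
  measurable B -> (forall l, B l -> (`|l| <= K)%R) ->
  \int[m]_(l in ~` B) (l ^+ 2)%:E < +oo -> \int[m]_l (l ^+ 2)%:E < +oo.
Proof.
move=> mB BK fin; rewrite -(setUv B) ge0_integral_setU//; last 4 first.
- exact: measurableC.
- by rewrite setUv; apply/measurable_EFinP; exact: measurable_funX.
- by move=> l _; rewrite lee_fin sqr_ge0.
- by apply/disj_setPCl.
apply: lte_add_pinfty fin.
apply: (@le_lt_trans _ _ (\int[m]_(l in B) (K ^+ 2)%:E)).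
  apply: ge0_le_integral => //.
  - by move=> l _; rewrite lee_fin sqr_ge0.
  - by apply/measurable_EFinP; exact: measurable_funX.
  - move=> l /BK lK; rewrite lee_fin -real_normK ?num_real//.
    by rewrite ler_pXn2r ?nnegrE// (le_trans _ lK).
rewrite integral_cst// lte_mul_pinfty ?lee_fin ?sqr_ge0//.
by rewrite -ge0_fin_numE//; exact: fin_num_measure.
Qed.

Lemma first_moment_integrable (m : {finite_measure set R -> \bar R}) :
  \int[m]_l (l ^+ 2)%:E < +oo -> m.-integrable setT (EFin \o @id R).
Proof.
move=> fin; apply: (@le_integrable _ _ _ m setT _ _
  (fun l => 1%:E + (l ^+ 2)%:E)) => //.
- by apply/measurable_EFinP; exact: measurable_id.
- move=> l _ /=; rewrite lee_fin [leRHS]ger0_norm ?addr_ge0 ?sqr_ge0//.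
  rewrite -(real_normK (num_real l)).
  by have := sqr_ge0 (`|l| - 1)%R; have := normr_ge0 l; nra.
- apply: integrableD => //; first exact: finite_measure_integrable_cst.
  apply/integrableP; split; first by apply/measurable_EFinP; exact: measurable_funX.
  by under eq_integral do rewrite abse_EFin ger0_norm ?sqr_ge0//.
Qed.

(** The part off B is expressed by a reference measure [m0], so that it is common to several m and
    cancels when they are combined. *)
Lemma moment_setU (m m0 : {finite_measure set R -> \bar R}) (B : set R) :
  measurable B -> (forall C, measurable C -> C `<=` ~` B -> m C = m0 C) ->
  m.-integrable setT (EFin \o @id R) ->
  Rintegral m setT id = (Rintegral m B id + Rintegral m0 (~` B) id)%R.
Proof.
move=> mB mm0 im; rewrite -(setUv B) Rintegral_setU ?setUv//; last 2 first.
- exact: measurableC.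
- by apply/disj_setPCl.
by congr (_ + fine _)%R; exact: eq_measure_integral.
Qed.

Lemma moment_itv (m : {finite_measure set R -> \bar R}) (a b : R)
    (B := `[a, b[%classic) :
  m.-integrable setT (EFin \o @id R) ->
  (a * fine (m B) <= Rintegral m B id <= b * fine (m B))%R.
Proof.
move=> im; have mB : measurable B by exact: measurable_itv.
have cB c : m.-integrable B (EFin \o (fun=> c)).
  exact: finite_measure_integrable_cst.
have iB : m.-integrable B (EFin \o @id R).
  exact: (@integrableS _ _ _ _ setT).
rewrite -!Rintegral_cst//; apply/andP; split; apply: le_Rintegral => // l;
  by rewrite /B /= in_itv /= => /andP[? /ltW].
Qed.

End moments.

Section defect.
Context (R : realType) (n : nat).
Variable E : set R -> (xtspace R n -> R[i]) -> (xtspace R n -> R[i]).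
Hypothesis pv : projection_valued_measure E.
Implicit Types (f g u h v : xtspace R n -> R[i]) (B C : set R).

Lemma nsq_set0 f : L2 f -> nsq E set0 f = 0.
Proof. by move=> Lf; rewrite /nsq (pvm_set0 pv). Qed.

(** Idempotence and symmetry: the spectral measure of E(B) f is that of f restricted to B. *)
Lemma nsq_pvm B C f : measurable B -> measurable C -> L2 f ->
  nsq E C (E B f) = nsq E (C `&` B) f.
Proof.
move=> mB mC Lf; have LB := pvm_L2 pv mB Lf.
have mCB : measurable (C `&` B) by exact: measurableI.
rewrite /nsq (pvm_setI pv)// (pvm_sym pv)//; last exact: (pvm_L2 pv).
by rewrite (pvm_setI pv)// setIC -setIA setIid.
Qed.

Definition polar (f g : xtspace R n -> R[i]) (k : 'I_4) : xtspace R n -> R[i] :=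
  fun z => f z + (0 +i* 1)%C ^+ k * g z.

Lemma L2_polar f g k : L2 f -> L2 g -> L2 (polar f g k).
Proof. by move=> Lf Lg; apply: L2D => //; exact: L2Z. Qed.

Lemma nsq_polar_pvm B C u v k : measurable B -> measurable C -> L2 u -> L2 v ->
  nsq E C (polar u (E B v) k) = nsq E C u + nsq E (C `&` B) v +
    2 * match val k with
    | 0 => complex.Re (inner u (E (C `&` B) v))
    | 1 => complex.Im (inner u (E (C `&` B) v))
    | 2 => - complex.Re (inner u (E (C `&` B) v))
    | _ => - complex.Im (inner u (E (C `&` B) v))
    end.
Proof.
move=> mB mC Lu Lv; rewrite (nsqP pv)//; last exact: (pvm_L2 pv).
by rewrite nsq_pvm// (pvm_setI pv).
Qed.

Lemma spectral_measure_ex f : L2 f ->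
  {m : {finite_measure set R -> \bar R} | (m : set R -> \bar R) = spectral_distribution E f}.
Proof.
by move=> Lf; exists [the {finite_measure set R -> \bar R} of spm pv Lf].
Qed.

(* The opaque witness keeps unification from unfolding integrals over
   [spectral_distribution]. *)
Definition spec f (Lf : L2 f) : {finite_measure set R -> \bar R} :=
  sval (spectral_measure_ex Lf).

Lemma spec_dist f (Lf : L2 f) : spectral_distribution E f = spec Lf.
Proof. by rewrite /spec; case: spectral_measure_ex. Qed.

Lemma specE f (Lf : L2 f) C : measurable C -> spec Lf C = (nsq E C f)%:E.
Proof. by move=> mC; rewrite -spec_dist /spectral_distribution (sqnorm_pvm pv). Qed.

Lemma Re_sum4 (c : 'I_4 -> R[i]) :
  4%:R^-1 * \sum_(k < 4) (0 +i* 1)%C ^+ k * c k =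
  ((4%:R^-1 * (complex.Re (c 0) - complex.Im (c 1) - complex.Re (c 2) + complex.Im (c 3)))
  +i* (4%:R^-1 * (complex.Im (c 0) + complex.Re (c 1) - complex.Im (c 2) - complex.Re (c 3))))%C.
Proof.
have four : 4%:R^-1 = (4%:R^-1 +i* 0)%C :> R[i].
  by rewrite -[RHS]/((4%:R^-1 : R)%:C)%C fmorphV rmorph_nat.
rewrite four !big_ord_recl big_ord0 /= !exprS !expr0.
rewrite (_ : lift ord0 ord0 = 1)%R; last exact/val_inj.
rewrite (_ : lift ord0 (lift ord0 ord0) = 2)%R; last exact/val_inj.
rewrite (_ : lift ord0 (lift ord0 (lift ord0 ord0)) = 3)%R; last exact/val_inj.
rewrite (_ : ord0 = 0)%R//.
by case: (c 0) (c 1) (c 2) (c 3) => [? ?] [? ?] [? ?] [? ?] /=; congr Complex; ring.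
Qed.

End defect.

(** * The size of A - a on a spectral cell *)

Section defect_bound.
Context (R : realType) (n : nat).
Variable E : set R -> (xtspace R n -> R[i]) -> (xtspace R n -> R[i]).
Hypothesis pv : projection_valued_measure E.
Implicit Types (f g u h v : xtspace R n -> R[i]) (B C : set R).

Lemma polar_measures f g : L2 f -> L2 g ->
  exists m : 'I_4 -> {finite_measure set R -> \bar R},
    forall k, (m k : set R -> \bar R) = spectral_distribution E (polar f g k).
Proof.
by move=> Lf Lg; exists (fun k => spec pv (L2_polar k Lf Lg)) => k;
  rewrite (spec_dist pv (L2_polar k Lf Lg)).
Qed.

Lemma spectral_formE phi f g (m : 'I_4 -> {finite_measure set R -> \bar R}) :
  (forall k, (m k : set R -> \bar R) = spectral_distribution E (polar f g k)) ->
  spectral_form E phi f g =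
  ((4%:R^-1 * (Rintegral (m 0) setT (cRe phi) - Rintegral (m 1) setT (cIm phi)
             - Rintegral (m 2) setT (cRe phi) + Rintegral (m 3) setT (cIm phi))) +i*
   (4%:R^-1 * (Rintegral (m 0) setT (cIm phi) + Rintegral (m 1) setT (cRe phi)
             - Rintegral (m 2) setT (cIm phi) - Rintegral (m 3) setT (cRe phi))))%C.
Proof.
move=> mD.
have H k : cintegral (spectral_distribution E (polar f g k)) phi =
    (Rintegral (m k) setT (cRe phi) +i* Rintegral (m k) setT (cIm phi))%C.
  by rewrite /cintegral -mD.
rewrite /spectral_form (eq_bigr (fun k : 'I_4 => (0 +i* 1)%C ^+ k *
    (Rintegral (m k) setT (cRe phi) +i* Rintegral (m k) setT (cIm phi))%C)).
  exact: Re_sum4.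
by move=> k _; rewrite -H.
Qed.

(** Off B the four polarization measures coincide and drop out, since the powers of i sum to 0. On B
    the identity function stays between a and a + d. *)
Lemma defect_bound u h v (a d : R) (B := `[a, (a + d)[%classic) :
  0 <= d -> L2 v -> spectral_integral E (fun l => (l%:C)%C) u h ->
  `|complex.Re (inner h (E B v)) - a * complex.Re (inner u (E B v))| +
  `|complex.Im (inner h (E B v)) - a * complex.Im (inner u (E B v))| <=
  d * (nsq E B u + nsq E B v).
Proof.
move=> d0 Lv [[Lu u2] Lh Eh].
have mB : measurable B by exact: measurable_itv.
have mBC : measurable (~` B) by exact: measurableC.
have Lw := pvm_L2 pv mB Lv.
have sqmod_id : (fun l : R => (sqmod (fun l => (l%:C)%C) l)%:E) =
    fun l => (l ^+ 2)%:E.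
  by apply/funext => l; rewrite /sqmod /cRe /cIm /= expr0n addr0.
have u2' : (\int[spec pv Lu]_l (l ^+ 2)%:E < +oo)%E by rewrite sqmod_id (spec_dist pv Lu) in u2.
have BK l : B l -> `|l| <= `|a| + d.
  rewrite /B /= in_itv /= => /andP[al la]; rewrite ler_norml.
  have := ler_norm a; have := ler_norm (- a); rewrite normrN.
  by move=> *; apply/andP; split; lra.
have outB C : C `<=` ~` B -> C `&` B = set0.
  by move=> CB; rewrite -subset0 => l [/CB].
(* The spectral measure of E(B) v lives on the bounded set B, so this vector is in the domain of A
   and [Eh] may be tested on it. *)
have w2 : (\int[spec pv Lw]_l (l ^+ 2)%:E < +oo)%E.
  apply: (second_moment_split mB BK).
  rewrite (eq_measure_integral mzero) ?integral_measure_zero//.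
  move=> C mC /outB CB; apply: etrans (specE pv Lw mC) _.
  by rewrite (nsq_pvm pv)// CB (nsq_set0 pv).
have dw : spectral_domain E (fun l => (l%:C)%C) (E B v).
  by split; [exact: Lw|rewrite sqmod_id (spec_dist pv Lw)].
have [m mD] := polar_measures Lu Lw.
have mE k C : measurable C -> m k C = (nsq E C (polar u (E B v) k))%:E.
  move=> mC; rewrite mD /spectral_distribution (sqnorm_pvm pv)//.
  exact: L2_polar.
(* Off B the cross term and the mass of v vanish for every k, so the measure with index 0 can serve
   as reference. *)
have mout k C : measurable C -> C `<=` ~` B -> m k C = m 0 C.
  move=> mC /outB CB; rewrite !mE// !(nsq_polar_pvm pv)// CB !(pvm_set0 pv)//=.
  by rewrite oppr0; case: (val k) => [|[|[|]]].
have intm k : (m k).-integrable setT (EFin \o @id R).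
  apply: first_moment_integrable; apply: (second_moment_split mB BK).
  rewrite (eq_measure_integral (spec pv Lu)).
    apply: le_lt_trans u2'; apply: ge0_subset_integral => //.
    - by apply/measurable_EFinP; exact: measurable_funX.
    - by move=> l _; rewrite lee_fin sqr_ge0.
  move=> C mC /outB CB; apply: etrans (mE k C mC) (etrans _ (esym (specE pv Lu mC))).
  rewrite (nsq_polar_pvm pv)// CB !(pvm_set0 pv)// (nsq_set0 pv)//=.
  by case: (val k) => [|[|[|?]]] /=; rewrite ?oppr0 mulr0 !addr0.
have splitB k : Rintegral (m k) setT id =
    Rintegral (m k) B id + Rintegral (m 0) (~` B) id.
  by apply: moment_setU => // C; exact: mout.
have bnd k : a * nsq E B (polar u (E B v) k) <= Rintegral (m k) B id <=
    (a + d) * nsq E B (polar u (E B v) k).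
  by have := moment_itv a (a + d) (intm k); rewrite -/B mE.
rewrite (Eh _ dw) (spectral_formE _ mD).
have reE k : Rintegral (m k) setT (cRe (fun l : R => (l%:C)%C)) =
    Rintegral (m k) setT id by [].
have imE k : Rintegral (m k) setT (cIm (fun l : R => (l%:C)%C)) = 0.
  by rewrite /cIm /= Rintegral_cst// mul0r.
rewrite !reE !imE !splitB.
move: (bnd 0) (bnd 1) (bnd 2) (bnd 3).
rewrite !(nsq_polar_pvm pv)// setIid.
have := nsq_ge0 pv mB Lu; have := nsq_ge0 pv mB Lv.
move: (nsq E B u) (nsq E B v) (inner u (E B v)) => nu nv [x y] /=.
move: (Rintegral (m 0) B id) (Rintegral (m 1) B id) (Rintegral (m 2) B id)
  (Rintegral (m 3) B id) (Rintegral _ _ _) => p0 p1 p2 p3 J.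
move=> nu0 nv0 /andP[l0 h0] /andP[l1 h1] /andP[l2 h2] /andP[l3 h3].
(* Each component involves two of the measures, whose masses on B add up to 2 (nu + nv); with the
   factor 1/4 it receives half of the bound. *)
set X := (X in `|X| + _); set Y := (X in _ + `|X|).
have : `|X| <= d * (nu + nv) / 2.
  by rewrite /X ler_norml; apply/andP; split; lra.
have : `|Y| <= d * (nu + nv) / 2.
  by rewrite /Y ler_norml; apply/andP; split; lra.
lra.
Qed.

End defect_bound.

Lemma cvgn_eq (R : realType) (u v : nat -> R) (a b : R) :
  (forall k, u k = v k) -> a = b -> v @ \oo --> b -> u @ \oo --> a.
Proof. by move=> /funext -> ->. Qed.

(** * The propagator as a limit of finite spectral sums *)

Section propagator.
Context (R : realType) (n : nat).
Variable E : set R -> (xtspace R n -> R[i]) -> (xtspace R n -> R[i]).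
Hypothesis pv : projection_valued_measure E.
Implicit Types (f g : xtspace R n -> R[i]) (B C : set R).

Lemma nsq_setT f : L2 f -> nsq E setT f = complex.Re (inner f f).
Proof. by move=> Lf; rewrite /nsq (pvm_setT pv). Qed.

(** A Bessel inequality: the cells are disjoint but leave the tails of the line uncovered. *)
Lemma nsq_cells f M : L2 f ->
  \sum_(j < ncells M) nsq E (cell M j) f <= nsq E setT f.
Proof.
move=> Lf; pose m := spec pv Lf.
have mE C : measurable C -> fine (m C) = nsq E C f by move=> mC; rewrite /m specE.
have is1 : m.-integrable setT (EFin \o step (fun=> 1) M).
  apply: (@le_integrable _ _ _ m setT _ _ (EFin \o (fun=> 1))) => //.
  - by apply/measurable_EFinP; exact: measurable_step.
  - by move=> l _ /=; rewrite lee_fin normr1 step_bound// => x; rewrite normr1.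
  - exact: finite_measure_integrable_cst.
rewrite (eq_bigr (fun j : 'I_(ncells M) => 1 * fine (m (cell M j)))); last first.
  by move=> j _; rewrite mul1r mE//; exact: measurable_cell.
rewrite -(integral_step m (fun=> 1)) -mE// -[leRHS]mul1r -Rintegral_cst//.
apply: le_Rintegral => //; first exact: finite_measure_integrable_cst.
move=> l _; apply: le_trans (ler_norm _) _.
by apply: (@step_bound _ (fun=> 1) 1) => // x; rewrite normr1.
Qed.

Lemma polar_masses f g C (m : 'I_4 -> {finite_measure set R -> \bar R}) :
  L2 f -> L2 g -> measurable C ->
  (forall k, (m k : set R -> \bar R) = spectral_distribution E (polar f g k)) ->
  complex.Re (inner f (E C g)) = 4%:R^-1 * (fine (m 0 C) - fine (m 2 C)) /\
  complex.Im (inner f (E C g)) = 4%:R^-1 * (fine (m 1 C) - fine (m 3 C)).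
Proof.
move=> Lf Lg mC mD.
have mE k : fine (m k C) = nsq E C (polar f g k).
  by rewrite mD /spectral_distribution (sqnorm_pvm pv)//; exact: L2_polar.
by rewrite !mE !(nsqP pv)//=; split; field.
Qed.

(** The two sums are the real and imaginary parts of \sum_j exp (- i s l_j) <f, E(B_j) g>.
    Polarization splits them into Riemann sums against four positive measures, each of which
    converges. *)
Lemma expNi_form_cvg f g (s : R) : L2 f -> L2 g ->
  (\sum_(j < ncells M) (cos (s * node R M j) * complex.Re (inner f (E (cell M j) g)) +
       sin (s * node R M j) * complex.Im (inner f (E (cell M j) g)))
     @[M --> \oo] --> complex.Re (spectral_form E (expNi s) f g)) /\
  (\sum_(j < ncells M) (cos (s * node R M j) * complex.Im (inner f (E (cell M j) g)) -
       sin (s * node R M j) * complex.Re (inner f (E (cell M j) g)))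
     @[M --> \oo] --> complex.Im (spectral_form E (expNi s) f g)).
Proof.
move=> Lf Lg; have [m mD] := polar_measures pv Lf Lg.
rewrite (spectral_formE _ mD).
have linc : continuous (fun l : R => s * l).
  by move=> l; apply: cvgM; [exact: cvg_cst|exact: cvg_id].
pose c l := cos (s * l); pose t l := - sin (s * l).
pose SC k M := \sum_(j < ncells M) c (node R M j) * fine (m k (cell M j)).
pose ST k M := \sum_(j < ncells M) t (node R M j) * fine (m k (cell M j)).
have cc k : SC k M @[M --> \oo] --> Rintegral (m k) setT (cRe (expNi s)).
  apply: (@riemann_sum_cvg _ _ c 1).
    by move=> l; apply: (@continuous_comp _ _ _ (fun l => s * l));
      [exact: linc|exact: continuous_cos].
  by move=> l; rewrite ler_norml cos_geN1 cos_le1.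
have ct k : ST k M @[M --> \oo] --> Rintegral (m k) setT (cIm (expNi s)).
  apply: (@riemann_sum_cvg _ _ t 1).
    move=> l; apply: cvgN; apply: (@continuous_comp _ _ _ (fun l => s * l));
      [exact: linc|exact: continuous_sin].
  by move=> l; rewrite normrN ler_norml sin_geN1 sin_le1.
have qE M (j : 'I_(ncells M)) := polar_masses Lf Lg (measurable_cell M j) mD.
split.
- apply: (@cvgn_eq _ _ (fun M => 4%:R^-1 * (SC 0 M - ST 1 M - SC 2 M + ST 3 M)) _ _ _ erefl).
    move=> M; rewrite -!sumrB -big_split mulr_sumr.
    by apply: eq_bigr => j _; cbv beta; rewrite (qE M j).1 (qE M j).2 /c /t /=; field.
  apply: (@cvgM _ _ _ _ (fun=> 4%:R^-1)); first exact: cvg_cst.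
  by apply: cvgD (ct 3); apply: cvgB (cc 2); exact: cvgB (cc 0) (ct 1).
- apply: (@cvgn_eq _ _ (fun M => 4%:R^-1 * (ST 0 M + SC 1 M - ST 2 M - SC 3 M)) _ _ _ erefl).
    move=> M; rewrite -big_split -!sumrB mulr_sumr.
    by apply: eq_bigr => j _; cbv beta; rewrite (qE M j).1 (qE M j).2 /c /t /=; field.
  apply: (@cvgM _ _ _ _ (fun=> 4%:R^-1)); first exact: cvg_cst.
  by apply: cvgB (cc 3); apply: cvgB (ct 2); exact: cvgD (ct 0) (cc 1).
Qed.

Lemma expNi_form0 f g : L2 f -> L2 g -> spectral_form E (expNi 0) f g = inner f g.
Proof.
move=> Lf Lg; have [m mD] := polar_measures pv Lf Lg.
rewrite (spectral_formE _ mD).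
have reE k : Rintegral (m k) setT (cRe (expNi 0)) = fine (m k setT).
  rewrite -[RHS]mul1r -Rintegral_cst//; apply: eq_Rintegral => l _.
  by rewrite /cRe /= mul0r cos0.
have imE k : Rintegral (m k) setT (cIm (expNi 0)) = 0.
  rewrite -[RHS](mul0r (fine (m k setT))) -Rintegral_cst//; apply: eq_Rintegral => l _.
  by rewrite /cIm /= mul0r sin0 oppr0.
have [] := polar_masses Lf Lg measurableT mD.
rewrite !(pvm_setT pv)// !reE !imE; case: (inner f g) => x y /= -> ->.
by congr Complex; ring.
Qed.

Lemma expNi_domain f s : L2 f -> spectral_domain E (expNi s) f.
Proof.
move=> Lf; split => //; rewrite (spec_dist pv Lf).
rewrite (eq_integral (fun=> 1%:E)) ?integral_cst//; last first.
  by move=> l _; rewrite /sqmod /cRe /cIm /= sqrrN cos2Dsin2.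
by rewrite mul1e -ge0_fin_numE//; exact: fin_num_measure.
Qed.

End propagator.

(** * From the weak evolution equation to the unitary group *)

Section unitary_group.
Context (R : realType) (n : nat).
Variable E : set R -> (xtspace R n -> R[i]) -> (xtspace R n -> R[i]).
Hypothesis pv : projection_valued_measure E.
Variables (u h : R -> xtspace R n -> R[i]) (S K : R).
Hypothesis uh : forall s, spectral_integral E (fun l => (l%:C)%C) (u s) (h s).
(** Together with [du_im] this says d/ds <u_s, g> = - i <h_s, g>, the weak form of i d/ds u = h. *)
Hypothesis du_re : forall (g : xtspace R n -> R[i]) (s : R), L2 g ->
  is_derive s (1 : R) (fun r : R => complex.Re (inner (u r) g)) (complex.Im (inner (h s) g)).
Hypothesis du_im : forall (g : xtspace R n -> R[i]) (s : R), L2 g ->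
  is_derive s (1 : R) (fun r : R => complex.Im (inner (u r) g)) (- complex.Re (inner (h s) g)).
Hypothesis uK : forall s, `|s| <= `|S| -> complex.Re (inner (u s) (u s)) <= K.
Variable g : xtspace R n -> R[i].
Hypothesis Lg : L2 g.

Let Lu s : L2 (u s). Proof. by have [[]] := uh s. Qed.

Let A M j (s : R) : R := complex.Re (inner (u s) (E (cell M j) g)).
Let D M j (s : R) : R := complex.Im (inner (u s) (E (cell M j) g)).
Let phase (a : R) M j (r : R) : R := S * (1 - r) * node R M j + a.

(* The [a]-rotated real part of <exp(- i (1 - r) S A) u_(r S), g>, with the
   spectrum discretized; it runs from <exp(- i S A) u_0, g> to <u_S, g>. *)
Let wave (a : R) M (r : R) : R := \sum_(j < ncells M)
  (cos (phase a M j r) * A M j (S * r) + sin (phase a M j r) * D M j (S * r)).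

(** The derivative - S l_j of the phase combines with that of u, so that only the defects <(A - l_j)
    u, E(B_j) g> remain. *)
Let dwave (a : R) M (r : R) : R := \sum_(j < ncells M)
  S * (cos (phase a M j r) *
        (complex.Im (inner (h (S * r)) (E (cell M j) g)) - node R M j * D M j (S * r)) -
       sin (phase a M j r) *
        (complex.Re (inner (h (S * r)) (E (cell M j) g)) - node R M j * A M j (S * r))).

Let is_derive_wave a M (r : R) : is_derive r (1 : R) (wave a M) (dwave a M r).
Proof.
rewrite (_ : wave a M = \sum_(j < ncells M) (fun r =>
  cos (phase a M j r) * A M j (S * r) + sin (phase a M j r) * D M j (S * r)));
    last first.
  by apply/funext => x; rewrite fct_sumE.
apply: is_derive_sum => j.
have Lj : L2 (E (cell M j) g) by apply: (pvm_L2 pv) => //; exact: measurable_cell.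
have dS : is_derive r (1 : R) (fun r : R => S * r) S.
  by apply: is_derive_eq; rewrite /GRing.scale /=; ring.
have dp : is_derive r (1 : R) (phase a M j) (- S * node R M j).
  rewrite /phase; apply: is_derive_eq.
  by rewrite /GRing.scale /=; ring.
have dA : is_derive r (1 : R) (A M j \o (fun r => S * r))
    (complex.Im (inner (h (S * r)) (E (cell M j) g)) * S).
  exact: (is_derive1_comp (du_re (S * r) Lj)).
have dD : is_derive r (1 : R) (D M j \o (fun r => S * r))
    (- complex.Re (inner (h (S * r)) (E (cell M j) g)) * S).
  exact: (is_derive1_comp (du_im (S * r) Lj)).
have dc : is_derive r (1 : R) (cos \o phase a M j) (- sin (phase a M j r) * (- S * node R M j)).
  exact: is_derive1_comp.
have ds : is_derive r (1 : R) (sin \o phase a M j) (cos (phase a M j r) * (- S * node R M j)).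
  exact: is_derive1_comp.
apply: is_derive_eq (is_deriveD (is_deriveM dc dA) (is_deriveM ds dD)) _.
by rewrite /GRing.scale /= /A /D; ring.
Qed.

(** Summed over the disjoint cells, the squared norms in the defect bounds stay below |u|^2 + |g|^2,
    so the growing number of cells does no harm. *)
Let dwave_le a M r : 0 <= r <= 1 ->
  `|dwave a M r| <= `|S| * (M.+1%:R^-1 * (K + nsq E setT g)).
Proof.
move=> r01.
have d0 : 0 <= (M.+1%:R^-1 : R) by rewrite invr_ge0.
have SrS : `|S * r| <= `|S|.
  by rewrite normrM ler_piMr// ger0_norm; case/andP: r01.
rewrite /dwave -mulr_sumr normrM ler_wpM2l//.
apply: (le_trans (ler_norm_sum _ _ _)).
apply: (@le_trans _ _ (\sum_(j < ncells M) M.+1%:R^-1 *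
    (nsq E (cell M j) (u (S * r)) + nsq E (cell M j) g))).
  apply: ler_sum => j _.
  have := defect_bound pv (node R M j) d0 Lg (uh (S * r)).
  rewrite -node_step -/(cell M j) /A /D; apply: le_trans.
  move: (inner (h _) _) (inner (u _) _) => [x y] [x' y'] /=.
  apply: le_trans (ler_normB _ _) _; rewrite !normrM addrC.
  by apply: lerD; rewrite ler_piMl// ?cos_max ?sin_max.
rewrite -mulr_sumr ler_wpM2l// big_split /=; apply: lerD; last exact: nsq_cells.
by apply: le_trans (nsq_cells pv M (Lu _)) _; rewrite (nsq_setT pv)// uK.
Qed.

Let wave_drift a M :
  `|wave a M 1 - wave a M 0| <= `|S| * (M.+1%:R^-1 * (K + nsq E setT g)).
Proof.
have cw : {within `[0, 1], continuous (wave a M)}.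
  apply: derivable_within_continuous => r _.
  by have [] := is_derive_wave a M r.
have [r] := @MVT_segment R (wave a M) (dwave a M) 0 1 ler01
  (fun r _ => is_derive_wave a M r) cw.
by rewrite in_itv /= => r01 ->; rewrite subr0 mulr1 dwave_le.
Qed.

Let drift_cvg0 : `|S| * (M.+1%:R^-1 * (K + nsq E setT g)) @[M --> \oo] --> 0.
Proof.
have -> : 0 = `|S| * (0 * (K + nsq E setT g)) by rewrite mul0r mulr0.
apply: (@cvgM _ _ _ _ (fun=> `|S|)); first exact: cvg_cst.
by apply: (@cvgM _ _ _ _ _ (fun=> K + nsq E setT g));
  [exact: cvg_harmonic|exact: cvg_cst].
Qed.

Let wave_limit a (x y : R) : wave a M 1 @[M --> \oo] --> x ->
  wave a M 0 @[M --> \oo] --> y -> x = y.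
Proof.
move=> wx wy; apply/eqP; rewrite -subr_eq0 -normr_eq0; apply/eqP.
have H : `|wave a M 1 - wave a M 0| @[M --> \oo] --> `|x - y|.
  by apply: cvg_norm; exact: cvgB wx wy.
apply/eqP; rewrite eq_le normr_ge0 andbT.
apply: (ler_cvg_to H drift_cvg0).
by apply: nearW => M; exact: wave_drift.
Qed.

Lemma inner_propagated : inner (u S) g = spectral_form E (expNi S) (u 0) g.
Proof.
(* At the end r = 1 no propagation is left, hence the group at time 0; at r = 0 all of it is
   left. *)
have [r1 i1] := expNi_form_cvg pv (0 : R) (Lu S) Lg.
have [r0 i0] := expNi_form_cvg pv S (Lu 0) Lg.
rewrite (expNi_form0 pv)// in r1 i1.
have re : complex.Re (inner (u S) g) = complex.Re (spectral_form E (expNi S) (u 0) g).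
  apply: (@wave_limit 0).
    apply: (@cvgn_eq _ _ _ _ _ _ erefl r1) => M; apply: eq_bigr => j _.
    by rewrite /phase /A /D subrr mulr0 addr0 mulr1.
  apply: (@cvgn_eq _ _ _ _ _ _ erefl r0) => M; apply: eq_bigr => j _.
  by rewrite /phase /A /D subr0 mulr0 addr0 mulr1.
have im : complex.Im (inner (u S) g) = complex.Im (spectral_form E (expNi S) (u 0) g).
  (* Since exp (- i pi / 2) = - i, this rotation turns the imaginary part into a real part. *)
  apply: (@wave_limit (pi / 2)).
    apply: (@cvgn_eq _ _ _ _ _ _ erefl i1) => M; apply: eq_bigr => j _.
    by rewrite /phase /A /D subrr mulr0 cosDpihalf sinDpihalf mulr1 mulNr addrC.
  apply: (@cvgn_eq _ _ _ _ _ _ erefl i0) => M; apply: eq_bigr => j _.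
  by rewrite /phase /A /D subr0 cosDpihalf sinDpihalf !(mulr0, mulr1) mulNr addrC.
by move: re im; case: (inner _ _) (spectral_form _ _ _ _) => [? ?] [? ?] /= -> ->.
Qed.

End unitary_group.

(** * The wave packet [exp (- sqrt w)] *)

Section partial_derivatives.
Context (R : realType) (n : nat).
Local Notation Z := (xtspace R n).
Implicit Types (f g : Z -> R) (z : Z) (df dg : option 'I_n -> Z -> R).

(** Total differentiability is bundled with the partials: [smooth] demands it and the chain rule
    uses it. *)
Definition has_partials f df := forall z,
  differentiable f z /\ forall d, 'D_(axis R d) f z = df d z.

Lemma has_partials_ext f g df dg : f = g -> (forall d z, df d z = dg d z) ->
  has_partials f df -> has_partials g dg.
Proof. by move=> <- e H z; have [D Hd] := H z; split => // d; rewrite Hd e. Qed.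

Lemma has_partials_cst c : has_partials (fun=> c) (fun _ _ => 0).
Proof.
by move=> z; split => [|d]; [exact: differentiable_cst|rewrite derive_cst].
Qed.

Lemma has_partialsD f g df dg : has_partials f df -> has_partials g dg ->
  has_partials (fun z => f z + g z) (fun d z => df d z + dg d z).
Proof.
move=> Hf Hg z; have [[Df Pf] [Dg Pg]] := (Hf z, Hg z); split => [|d].
  exact: differentiableD.
by rewrite deriveD ?Pf ?Pg//; exact: diff_derivable.
Qed.

Lemma has_partialsM f g df dg : has_partials f df -> has_partials g dg ->
  has_partials (fun z => f z * g z) (fun d z => f z * dg d z + g z * df d z).
Proof.
move=> Hf Hg z; have [[Df Pf] [Dg Pg]] := (Hf z, Hg z); split => [|d].
  exact: differentiableM.
by rewrite deriveM ?Pf ?Pg//; exact: diff_derivable.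
Qed.

Lemma has_partials_comp f df (phi dphi : R -> R) :
  (forall z, is_derive (f z) 1 phi (dphi (f z))) -> has_partials f df ->
  has_partials (fun z => phi (f z)) (fun d z => dphi (f z) * df d z).
Proof.
move=> Hphi Hf z; have [Df Pf] := Hf z; have [Dphi Pphi] := Hphi z.
have Dphi' : differentiable phi (f z) by exact/derivable1_diffP.
have Dc : differentiable (phi \o f) z by exact: differentiable_comp.
split => // d; rewrite (deriveE _ Dc) diff_comp//= -(deriveE _ Df) Pf.
by rewrite diff1E// derive1E Pphi mulrC.
Qed.

Definition xcoord (j : 'I_n) z : R := z.1 ord0 j.
Definition tcoord z : R := z.2.

Lemma xcoord_linear j : linear (xcoord j).
Proof. by move=> a x y; rewrite /xcoord /= !mxE. Qed.

Lemma tcoord_linear : linear tcoord.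
Proof. by []. Qed.

HB.instance Definition _ j :=
  GRing.isLinear.Build R Z R *:%R (xcoord j) (xcoord_linear j).
HB.instance Definition _ :=
  GRing.isLinear.Build R Z R *:%R tcoord tcoord_linear.

Lemma xcoord_continuous j : continuous (xcoord j).
Proof.
move=> z; apply: (@continuous_comp _ _ _ fst (fun x : 'rV[R]_n => x ord0 j)).
  exact: cvg_fst.
exact: coord_continuous.
Qed.

Lemma tcoord_continuous : continuous tcoord.
Proof. by move=> z; exact: cvg_snd. Qed.

Lemma has_partials_xcoord j :
  has_partials (xcoord j) (fun d _ => if d is Some k then (j == k)%:R else 0).
Proof.
move=> z; have D := linear_differentiable z (@xcoord_continuous j).
split => // d; rewrite deriveE// diff_lin//; last exact: xcoord_continuous.
by case: d => [k|] /=; rewrite /xcoord mxE ?eqxx.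
Qed.

Lemma has_partials_tcoord :
  has_partials tcoord (fun d _ => if d is Some k then 0 else 1).
Proof.
move=> z; have D := linear_differentiable z tcoord_continuous.
split => // d; rewrite deriveE// diff_lin//; last exact: tcoord_continuous.
by case: d.
Qed.

End partial_derivatives.

(** * The square root of w and its partial derivatives *)

Section wave_packet.
Context (R : realType) (n : nat).
Local Notation Z := (xtspace R n).
Implicit Types (f g : Z -> R) (z : Z) (d : option 'I_n).

(* [w_re + i w_im = 1 + |x|^2 / 2 + i t], [w_abs] is its modulus and
   [s_re + i s_im] its principal square root. *)
Definition w_re z : R := 1 + (\sum_j xcoord j z ^+ 2) / 2.
Definition w_im z : R := tcoord z.
Definition w_abs z : R := Num.sqrt (w_re z ^+ 2 + w_im z ^+ 2).
Definition s_re z : R := Num.sqrt ((w_abs z + w_re z) / 2).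
Definition s_im z : R := w_im z / (2 * s_re z).

Lemma w_re_ge1 z : 1 <= w_re z.
Proof.
by rewrite /w_re lerDl divr_ge0// sumr_ge0// => j _; rewrite sqr_ge0.
Qed.

Lemma w_abs_sqr z : w_abs z ^+ 2 = w_re z ^+ 2 + w_im z ^+ 2.
Proof. by rewrite sqr_sqrtr// addr_ge0 ?sqr_ge0. Qed.

Lemma w_re_le z : w_re z <= w_abs z.
Proof.
rewrite -(@ler_pXn2r _ 2)// ?nnegrE ?sqrtr_ge0 ?(le_trans _ (w_re_ge1 z))//.
by rewrite w_abs_sqr lerDl sqr_ge0.
Qed.

Lemma w_abs_ge1 z : 1 <= w_abs z.
Proof. exact: le_trans (w_re_ge1 z) (w_re_le z). Qed.

Lemma w_abs_gt0 z : 0 < w_abs z.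
Proof. exact: lt_le_trans ltr01 (w_abs_ge1 z). Qed.

Lemma s_re_sqr z : s_re z ^+ 2 = (w_abs z + w_re z) / 2.
Proof.
rewrite sqr_sqrtr//.
by have := w_abs_ge1 z; have := w_re_ge1 z; lra.
Qed.

Lemma s_re_ge1 z : 1 <= s_re z.
Proof.
rewrite -(@ler_pXn2r _ 2)// ?nnegrE ?sqrtr_ge0// s_re_sqr expr1n.
by have := w_abs_ge1 z; have := w_re_ge1 z; lra.
Qed.

Lemma s_re_gt0 z : 0 < s_re z.
Proof. exact: lt_le_trans ltr01 (s_re_ge1 z). Qed.

Lemma s_sqr_im z : 2 * s_re z * s_im z = w_im z.
Proof. by rewrite /s_im; field; rewrite gt_eqF ?s_re_gt0. Qed.

Lemma s_abs z : s_re z ^+ 2 + s_im z ^+ 2 = w_abs z.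
Proof.
have p0 := s_re_gt0 z.
(* With [w_re] and [w_im] expressed by the root, |w|^2 = (Re w)^2 + (Im w)^2 says that four times
   this product is 0. *)
have : (s_re z ^+ 2) * (s_re z ^+ 2 + s_im z ^+ 2 - w_abs z) = 0.
  have E : (w_im z) ^+ 2 = 4 * s_re z ^+ 2 * s_im z ^+ 2 by rewrite -s_sqr_im; ring.
  have := w_abs_sqr z; rewrite E; have := s_re_sqr z => /(congr1 ( *%R^~ 2)).
  rewrite mulfVK// => e.
  have -> : w_re z = s_re z ^+ 2 * 2 - w_abs z by rewrite e addrAC subrr add0r.
  by move=> e2; nra.
by move/eqP; rewrite mulf_eq0 expf_eq0/= gt_eqF//= subr_eq0 => /eqP.
Qed.

Lemma s_sqr_re z : s_re z ^+ 2 - s_im z ^+ 2 = w_re z.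
Proof. by have := s_abs z; have := s_re_sqr z; lra. Qed.

Definition dw_re d z : R := if d is Some j then xcoord j z else 0.
Definition dw_im d (z : Z) : R := if d is Some _ then 0 else 1.

Lemma partials_w_re : has_partials w_re dw_re.
Proof.
(* The rules for sums are binary, so the sum is differentiated by induction on the list of
   indices. *)
have H (s : seq 'I_n) : has_partials (fun z : Z => \sum_(j <- s) xcoord j z ^+ 2)
    (fun d z => \sum_(j <- s) 2 * xcoord j z * (if d is Some k then (j == k)%:R else 0)).
  elim: s => [|j s IH].
    apply: has_partials_ext (has_partials_cst 0) => [|d z]; last by rewrite big_nil.
    by apply/funext => z; rewrite big_nil.
  have Hx := @has_partials_xcoord R n j.
  apply: has_partials_ext (has_partialsD (has_partialsM Hx Hx) IH) => [|d z].
    by apply/funext => z; rewrite big_cons expr2.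
  by rewrite big_cons; congr (_ + _); case: d => [k|];
    rewrite ?mulr0 ?addr0 -?mulrDl ?mulr2n ?mulrDl ?mul1r/=.
apply: has_partials_ext
  (has_partialsD (has_partials_cst 1) (has_partialsM (H _) (has_partials_cst 2^-1))) => // d z.
rewrite mulr0 !add0r; case: d => [k|] /=.
  rewrite (bigD1 k)//= eqxx big1 ?addr0 ?mulr1; first by field.
  by move=> j jk; rewrite (negbTE jk) mulr0.
by rewrite big1 ?mulr0// => j _; rewrite mulr0.
Qed.

Lemma partials_w_im : has_partials w_im dw_im.
Proof. exact: has_partials_tcoord. Qed.

Lemma partials_w_abs : has_partials w_abs
  (fun d z => (dw_re d z * w_re z + dw_im d z * w_im z) / w_abs z).
Proof.
have a2 := has_partialsM partials_w_re partials_w_re.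
have b2 := has_partialsM partials_w_im partials_w_im.
have dsqrt z : is_derive (w_re z * w_re z + w_im z * w_im z) 1 Num.sqrt
    ((fun y => (2 * Num.sqrt y)^-1) (w_re z * w_re z + w_im z * w_im z)).
  apply: is_derive1_sqrt; rewrite -!expr2 -w_abs_sqr exprn_gt0//.
  exact: w_abs_gt0.
apply: has_partials_ext (has_partials_comp (dphi := fun y => (2 * Num.sqrt y)^-1) dsqrt (has_partialsD a2 b2)).
- by apply/funext => z; rewrite /w_abs !expr2.
- move=> d z; cbv beta; rewrite -!expr2 -/(w_abs z); field.
  by rewrite gt_eqF// w_abs_gt0.
Qed.

(* [dS = dw / (2 S)] for [S = s_re + i s_im], and [1 / S = conj S / w_abs] *)
Definition ds_re d z : R :=
  (dw_re d z * s_re z + dw_im d z * s_im z) / (2 * w_abs z).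
Definition ds_im d z : R :=
  (dw_im d z * s_re z - dw_re d z * s_im z) / (2 * w_abs z).

Lemma partials_s_re : has_partials s_re ds_re.
Proof.
have H := has_partialsM (has_partialsD partials_w_abs partials_w_re)
  (has_partials_cst 2^-1).
have dsqrt z : is_derive ((w_abs z + w_re z) / 2) 1 Num.sqrt
    ((fun y => (2 * Num.sqrt y)^-1) ((w_abs z + w_re z) / 2)).
  by apply: is_derive1_sqrt; rewrite -s_re_sqr exprn_gt0//; exact: s_re_gt0.
apply: has_partials_ext (has_partials_comp (dphi := fun y => (2 * Num.sqrt y)^-1) dsqrt H).
- by [].
- move=> d z; cbv beta; rewrite -/(s_re z) /ds_re.
  (* Writing w and |w| as polynomials in [s_re] and [s_im] leaves a rational identity. *)
  rewrite -(s_sqr_re z) -(s_sqr_im z) -(s_abs z).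
  have pz := s_re_gt0 z; have mz := w_abs_gt0 z; rewrite -s_abs in mz.
  by field; rewrite !gt_eqF.
Qed.

Lemma is_derive_inv (y : R) : y != 0 ->
  is_derive y 1 GRing.inv ((fun y => - (y ^+ 2)^-1) y).
Proof.
move=> y0; apply: is_derive_eq; first exact: is_deriveV.
by rewrite /GRing.scale /= mulr1.
Qed.

(** As a quotient, [s_im] is differentiable also at t = 0; the formula sqrt ((|w| - Re w) / 2) would
    give its absolute value, which is not. *)
Lemma partials_s_im : has_partials s_im ds_im.
Proof.
have p0 z : 2 * s_re z != 0 by rewrite mulf_neq0// gt_eqF// s_re_gt0.
have H := has_partials_comp (dphi := fun y => - (y ^+ 2)^-1)
  (fun z => is_derive_inv (p0 z))
  (has_partialsM (has_partials_cst 2) partials_s_re).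
apply: has_partials_ext (has_partialsM partials_w_im H).
- by [].
- move=> d z; cbv beta; rewrite /ds_im /ds_re -(s_sqr_im z) -(s_abs z).
  have pz := s_re_gt0 z; have mz := w_abs_gt0 z; rewrite -s_abs in mz.
  by field; rewrite !gt_eqF.
Qed.

(** The one reciprocal that differentiating the root introduces; its own derivatives are polynomial
    in it. *)
Definition v_abs z : R := (w_abs z)^-1.

Lemma partials_v_abs : has_partials v_abs
  (fun d z => - (dw_re d z * w_re z + dw_im d z * w_im z) * v_abs z ^+ 3).
Proof.
have m0 z : w_abs z != 0 by rewrite gt_eqF// w_abs_gt0.
apply: has_partials_ext
  (has_partials_comp (dphi := fun y => - (y ^+ 2)^-1)
  (fun z => is_derive_inv (m0 z)) partials_w_abs).
- by [].
- move=> d z; cbv beta; rewrite /v_abs; field.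
  by rewrite gt_eqF// w_abs_gt0.
Qed.

End wave_packet.

(** * Moderate and rapidly decreasing expressions *)

Section rapid_decay.
Context (R : realType) (n : nat).
Local Notation Z := (xtspace R n).
Local Notation mZ := ('rV[R]_n * measurableTypeR R)%type.
Implicit Types (f g : Z -> R) (z : Z) (d : option 'I_n).

(** An algebra closed under partial derivatives, all of whose generators are bounded by a constant
    or by |w|. Generating it syntactically makes growth and measurability provable by induction. *)
Inductive moderate : (Z -> R) -> Prop :=
| moderate_cst c : moderate (fun=> c)
| moderate_x j : moderate (xcoord j)
| moderate_t : moderate (@tcoord R n)
| moderate_re : moderate (@s_re R n)
| moderate_im : moderate (@s_im R n)
| moderate_v : moderate (@v_abs R n)
| moderateD f g : moderate f -> moderate g -> moderate (fun z => f z + g z)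
| moderateM f g : moderate f -> moderate g -> moderate (fun z => f z * g z).

Lemma moderate_ext f g : (forall z, f z = g z) -> moderate g -> moderate f.
Proof. by move=> /funext ->. Qed.

Lemma moderate_dw_re d : moderate (dw_re d).
Proof. by case: d => [j|]; [exact: moderate_x|exact: moderate_cst]. Qed.

Lemma moderate_dw_im d : moderate (dw_im d).
Proof. by case: d => [j|]; exact: moderate_cst. Qed.

Ltac moderate_tac := repeat first
  [assumption|exact: moderate_cst|exact: moderate_x|exact: moderate_t
  |exact: moderate_re|exact: moderate_im|exact: moderate_v
  |exact: moderate_dw_re|exact: moderate_dw_im|apply: moderateM|apply: moderateD].

Lemma moderate_w_re : moderate (@w_re R n).
Proof.
rewrite (_ : @w_re R n = fun z => s_re z * s_re z + (-1) * (s_im z * s_im z)).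
  by moderate_tac.
by apply/funext => z; rewrite -s_sqr_re; ring.
Qed.

Lemma moderate_ds_re d : moderate (ds_re d).
Proof.
rewrite (_ : ds_re d = fun z =>
    2^-1 * v_abs z * (dw_re d z * s_re z + dw_im d z * s_im z)).
  by moderate_tac.
by apply/funext => z; rewrite /ds_re /v_abs; field; rewrite gt_eqF// w_abs_gt0.
Qed.

Lemma moderate_ds_im d : moderate (ds_im d).
Proof.
rewrite (_ : ds_im d = fun z =>
    2^-1 * v_abs z * (dw_im d z * s_re z + (-1) * (dw_re d z * s_im z))).
  by moderate_tac.
by apply/funext => z; rewrite /ds_im /v_abs; field; rewrite gt_eqF// w_abs_gt0.
Qed.

Lemma moderate_partials f : moderate f ->
  exists2 df, has_partials f df & forall d, moderate (df d).
Proof.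
elim => {f} [c|j||||||].
- by exists (fun _ _ => 0); [exact: has_partials_cst|move=> d; exact: moderate_cst].
- eexists; first exact: has_partials_xcoord.
  by case => [k|]; exact: moderate_cst.
- eexists; first exact: has_partials_tcoord.
  by case => [k|]; exact: moderate_cst.
- by eexists; [exact: partials_s_re|exact: moderate_ds_re].
- by eexists; [exact: partials_s_im|exact: moderate_ds_im].
- eexists; first exact: partials_v_abs.
  move=> d; apply: (@moderate_ext _ (fun z => (-1) *
      (dw_re d z * w_re z + dw_im d z * w_im z) * (v_abs z * (v_abs z * v_abs z)))).
    by move=> z; ring.
  by have mw := moderate_w_re; moderate_tac.
- move=> f g _ [df Hf mf] _ [dg Hg mg]; eexists; first exact: has_partialsD Hf Hg.
  by move=> d; constructor.
- move=> f g Mf [df Hf mf] Mg [dg Hg mg]; eexists; first exact: has_partialsM Hf Hg.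
  by move=> d; do !constructor.
Qed.

Definition e_re z : R := expR (- s_re z) * cos (s_im z).
Definition e_im z : R := - (expR (- s_re z) * sin (s_im z)).

(** The module over the moderate functions generated by the two parts of exp (- S). It is closed
    under partial derivatives since those of exp (- S) are moderate multiples of it. *)
Inductive rapid : (Z -> R) -> Prop :=
| rapid_re : rapid e_re
| rapid_im : rapid e_im
| rapidD f g : rapid f -> rapid g -> rapid (fun z => f z + g z)
| rapidM f g : moderate f -> rapid g -> rapid (fun z => f z * g z).

Lemma rapid_ext f g : (forall z, f z = g z) -> rapid g -> rapid f.
Proof. by move=> /funext ->. Qed.

Lemma partials_exp : has_partials (fun z => expR (- s_re z))
  (fun d z => - ds_re d z * expR (- s_re z)).
Proof.
have H := has_partialsM (has_partials_cst (-1)) (@partials_s_re R n).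
have dexp z : is_derive (-1 * s_re z) 1 expR (expR (-1 * s_re z)).
  exact: is_derive_expR.
apply: has_partials_ext (has_partials_comp (dphi := expR) dexp H).
- by apply/funext => z; rewrite mulN1r.
- by move=> d z; cbv beta; rewrite mulN1r; ring.
Qed.

Lemma partials_e_re : has_partials e_re
  (fun d z => - ds_re d z * e_re z + ds_im d z * e_im z).
Proof.
have dcos z : is_derive (s_im z : R) 1 (@cos R) (- sin (s_im z)) := is_derive_cos _.
apply: has_partials_ext (has_partialsM partials_exp
  (has_partials_comp (dphi := fun y => - sin y) dcos (@partials_s_im R n))).
- by [].
- by move=> d z; rewrite /e_re /e_im; ring.
Qed.

Lemma partials_e_im : has_partials e_im
  (fun d z => - ds_re d z * e_im z - ds_im d z * e_re z).
Proof.
have dsin z : is_derive (s_im z : R) 1 (@sin R) (cos (s_im z)) := is_derive_sin _.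
apply: has_partials_ext (has_partialsM (has_partials_cst (-1))
  (has_partialsM partials_exp
    (has_partials_comp (dphi := @cos R) dsin (@partials_s_im R n)))).
- by apply/funext => z; rewrite mulN1r.
- by move=> d z; rewrite /e_re /e_im; ring.
Qed.

Ltac rapid_tac := repeat first
  [exact: rapid_re|exact: rapid_im|apply: rapidM; first by
    repeat first [exact: moderate_ds_re|exact: moderate_ds_im|exact: moderate_cst
                 |apply: moderateM]
  |apply: rapidD].

Lemma rapid_partials f : rapid f ->
  exists2 df, has_partials f df & forall d, rapid (df d).
Proof.
elim => {f}.
- eexists; first exact: partials_e_re.
  move=> d; apply: (@rapid_ext _ (fun z => (-1 * ds_re d z) * e_re z + ds_im d z * e_im z)).
    by move=> z; ring.
  by rapid_tac.
- eexists; first exact: partials_e_im.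
  move=> d; apply: (@rapid_ext _ (fun z =>
      (-1 * ds_re d z) * e_im z + (-1 * ds_im d z) * e_re z)).
    by move=> z; ring.
  by rapid_tac.
- move=> f g _ [df Hf mf] _ [dg Hg mg]; eexists; first exact: has_partialsD Hf Hg.
  by move=> d; constructor.
- move=> f g Mf rg [dg Hg mg]; have [df Hf mf] := moderate_partials Mf.
  eexists; first exact: has_partialsM Hf Hg.
  move=> d; apply: (@rapid_ext _ (fun z => f z * dg d z + df d z * g z)).
    by move=> z; rewrite (mulrC (g z)).
  by apply: rapidD; apply: rapidM.
Qed.

(** From |x_j| <= (1 + x_j^2) / 2. *)
Lemma xcoord_le j z : `|xcoord j z| <= w_abs z.
Proof.
apply: le_trans (w_re_le z); rewrite /w_re (bigD1 j)//=.
set s := \sum_(_ | _) _; have s0 : 0 <= s by apply: sumr_ge0 => k _; exact: sqr_ge0.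
rewrite -(real_normK (num_real (xcoord j z))).
by have := sqr_ge0 (`|xcoord j z| - 1); nra.
Qed.

Lemma tcoord_le z : `|tcoord z| <= w_abs z.
Proof.
rewrite -(@ler_pXn2r _ 2)// ?nnegrE ?sqrtr_ge0// w_abs_sqr real_normK ?num_real//.
by rewrite lerDr sqr_ge0.
Qed.

Lemma s_re_le z : `|s_re z| <= w_abs z.
Proof.
rewrite ger0_norm ?sqrtr_ge0//; have := s_re_ge1 z; have := s_abs z.
by have := sqr_ge0 (s_im z); nra.
Qed.

Lemma s_im_le z : `|s_im z| <= w_abs z.
Proof.
have := s_re_ge1 z; rewrite -s_abs -(real_normK (num_real (s_im z))).
by have := sqr_ge0 (`|s_im z| - 1); nra.
Qed.

(** As |w| >= 1, exponents may be raised, so bounds of different degrees can be added. *)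
Lemma moderate_le f : moderate f -> exists C k, forall z, `|f z| <= C * w_abs z ^+ k.
Proof.
have one z (x : R) : x <= w_abs z -> x <= 1 * w_abs z ^+ 1 by rewrite mul1r expr1.
elim => {f} [c|j||||||].
- by exists `|c|, 0%N => z; rewrite expr0 mulr1.
- by exists 1, 1%N => z; apply: one; exact: xcoord_le.
- by exists 1, 1%N => z; apply: one; exact: tcoord_le.
- by exists 1, 1%N => z; apply: one; exact: s_re_le.
- by exists 1, 1%N => z; apply: one; exact: s_im_le.
- exists 1, 1%N => z; apply: one; apply: le_trans (w_abs_ge1 z).
  rewrite /v_abs ger0_norm ?invr_ge0 ?(ltW (w_abs_gt0 z))//.
  by rewrite invf_le1 ?w_abs_ge1 ?w_abs_gt0.
- move=> f g _ [C [k Hf]] _ [D [l Hg]].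
  exists (`|C| + `|D|), (k + l)%N => z; apply: le_trans (ler_normD _ _) _.
  rewrite mulrDl; apply: lerD.
    apply: le_trans (Hf z) _; apply: le_trans (ler_wpM2r _ (ler_norm _)) _.
      by rewrite exprn_ge0// (ltW (w_abs_gt0 z)).
    by rewrite ler_wpM2l// ler_weXn2l ?w_abs_ge1// leq_addr.
  apply: le_trans (Hg z) _; apply: le_trans (ler_wpM2r _ (ler_norm _)) _.
    by rewrite exprn_ge0// (ltW (w_abs_gt0 z)).
  by rewrite ler_wpM2l// ler_weXn2l ?w_abs_ge1// leq_addl.
- move=> f g _ [C [k Hf]] _ [D [l Hg]].
  exists (C * D), (k + l)%N => z.
  by rewrite normrM exprD mulrACA ler_pM.
Qed.

(** Split exp y into k + 1 equal factors: k of them dominate y / (k + 1) and the last is at least 1.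
    Using k + 1 instead of k covers k = 0. *)
Lemma exp_pow_le (k : nat) : exists C : R, forall y, 0 <= y -> y ^+ k * expR (- y) <= C.
Proof.
exists (k.+1%:R ^+ k) => y y0.
rewrite expRN ler_pdivrMr ?expR_gt0//.
have -> : expR y = expR (y / k.+1%:R) ^+ k.+1.
  by rewrite -expRM_natr divfK// pnatr_eq0.
have yk0 : 0 <= y / k.+1%:R by rewrite divr_ge0.
have e1 : y / k.+1%:R <= expR (y / k.+1%:R).
  by apply: le_trans (expR_ge1Dx _); rewrite lerDr.
have e2 : 1 <= expR (y / k.+1%:R).
  by apply: le_trans (expR_ge1Dx _); rewrite lerDl.
have yE : y = k.+1%:R * (y / k.+1%:R) by rewrite mulrC divfK// pnatr_eq0.
rewrite [in leLHS]yE exprMn ler_wpM2l ?exprn_ge0//.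
rewrite exprS -[leLHS]mul1r ler_pM// ?exprn_ge0//.
by apply: lerXn2r => //; rewrite nnegrE// expR_ge0.
Qed.

(** Since Re w >= 0, |w| <= 2 s_re^2; powers of |w| thus become powers of [s_re], which exp (- s_re)
    absorbs. *)
Lemma rapid_le f : rapid f -> forall k, exists C, forall z, w_abs z ^+ k * `|f z| <= C.
Proof.
have base k : exists C, forall z, w_abs z ^+ k * expR (- s_re z) <= C.
  have [C HC] := exp_pow_le (2 * k); exists (2 ^+ k * C) => z.
  have p1 := s_re_ge1 z; have p0 : 0 <= s_re z by exact: le_trans p1.
  apply: le_trans (_ : 2 ^+ k * (s_re z ^+ (2 * k) * expR (- s_re z)) <= _); last first.
    by rewrite ler_wpM2l// HC.
  rewrite mulrA ler_wpM2r ?expR_ge0// exprM -exprMn lerXn2r ?nnegrE ?(ltW (w_abs_gt0 z))//.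
    by rewrite mulr_ge0// sqr_ge0.
  by rewrite s_re_sqr; have := w_re_ge1 z; lra.
elim => {f}.
- move=> k; have [C HC] := base k; exists C => z; apply: le_trans (HC z).
  rewrite ler_wpM2l ?exprn_ge0 ?(ltW (w_abs_gt0 z))// normrM ger0_norm ?expR_ge0//.
  by rewrite ler_piMr ?expR_ge0// cos_max.
- move=> k; have [C HC] := base k; exists C => z; apply: le_trans (HC z).
  rewrite ler_wpM2l ?exprn_ge0 ?(ltW (w_abs_gt0 z))// normrN normrM ger0_norm ?expR_ge0//.
  by rewrite ler_piMr ?expR_ge0// sin_max.
- move=> f g _ IHf _ IHg k; have [C HC] := IHf k; have [D HD] := IHg k.
  exists (C + D) => z; apply: le_trans (lerD (HC z) (HD z)).
  by rewrite -mulrDr ler_wpM2l ?ler_normD// exprn_ge0// (ltW (w_abs_gt0 z)).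
- move=> f g /moderate_le[C [l HC]] _ IHg k; have [D HD] := IHg (k + l)%N.
  exists (`|C| * D) => z; apply: le_trans (ler_wpM2l (normr_ge0 C) (HD z)).
  rewrite normrM exprD [leRHS](_ : _ = w_abs z ^+ k * ((`|C| * w_abs z ^+ l) * `|g z|)).
    rewrite ler_wpM2l ?exprn_ge0 ?(ltW (w_abs_gt0 z))// ler_wpM2r//.
    apply: le_trans (HC z) _; rewrite ler_wpM2r ?ler_norm//.
    by rewrite exprn_ge0// (ltW (w_abs_gt0 z)).
  by ring.
Qed.

Lemma norm_le_w_abs z : 1 + `|z| <= 2 * w_abs z.
Proof.
suff : `|z| <= w_abs z by have := w_abs_ge1 z; lra.
rewrite prod_normE ge_max; apply/andP; split; last exact: tcoord_le.
have [/eqP|/mx_norm_neq0[i E]] := boolP (mx_norm z.1 == 0).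
  by move=> E; rewrite [leLHS]E (ltW (w_abs_gt0 z)).
by rewrite [leLHS]E (ord1 i.1); exact: xcoord_le.
Qed.

(** The sigma-algebra of ['rV[R]_n] is generated by the coordinates, so measurability is built up
    from them rather than deduced from continuity on the whole space. *)
Lemma measurable_xcoord j : measurable_fun (setT : set mZ) (xcoord j).
Proof. exact: measurableT_comp (measurable_coord j) measurable_fst. Qed.

Lemma measurable_tcoord : measurable_fun (setT : set mZ) (@tcoord R n).
Proof. exact: measurable_snd. Qed.

Lemma measurable_w_re : measurable_fun (setT : set mZ) (@w_re R n).
Proof.
apply: measurable_funD => //; apply: measurable_funM => //.
by apply: measurable_sum => j; apply: measurable_funX; exact: measurable_xcoord.
Qed.

Lemma measurable_sqrt : measurable_fun setT (@Num.sqrt R).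
Proof. by apply: continuous_measurable_fun; exact: sqrt_continuous. Qed.

Lemma measurable_w_abs : measurable_fun (setT : set mZ) (@w_abs R n).
Proof.
apply: measurableT_comp measurable_sqrt _; apply: measurable_funD.
  by apply: measurable_funX; exact: measurable_w_re.
by apply: measurable_funX; exact: measurable_tcoord.
Qed.

Lemma measurable_s_re : measurable_fun (setT : set mZ) (@s_re R n).
Proof.
apply: measurableT_comp measurable_sqrt _; apply: measurable_funM => //.
by apply: measurable_funD; [exact: measurable_w_abs|exact: measurable_w_re].
Qed.

Lemma measurable_inv_pos (f : mZ -> R) : (forall z, 0 < f z) ->
  measurable_fun (setT : set mZ) f -> measurable_fun (setT : set mZ) (fun z => (f z)^-1).
Proof.
move=> f0 mf; rewrite (_ : (fun z => _) = (@powR R ^~ (-1)) \o f).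
  exact: measurableT_comp (measurable_powR _) mf.
by apply/funext => z /=; rewrite powR_inv1// ltW.
Qed.

Lemma measurable_v_abs : measurable_fun (setT : set mZ) (@v_abs R n).
Proof. by apply: measurable_inv_pos measurable_w_abs => z; exact: w_abs_gt0. Qed.

Lemma measurable_s_im : measurable_fun (setT : set mZ) (@s_im R n).
Proof.
apply: measurable_funM; first exact: measurable_tcoord.
apply: measurable_inv_pos => [z|]; first by rewrite mulr_gt0// s_re_gt0.
by apply: measurable_funM => //; exact: measurable_s_re.
Qed.

Lemma moderate_measurable f : moderate f -> measurable_fun (setT : set mZ) f.
Proof.
elim => {f} //.
- exact: measurable_xcoord.
- exact: measurable_tcoord.
- exact: measurable_s_re.
- exact: measurable_s_im.
- exact: measurable_v_abs.
- by move=> f g _ mf _ mg; exact: measurable_funD.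
- by move=> f g _ mf _ mg; exact: measurable_funM.
Qed.

Lemma rapid_measurable f : rapid f -> measurable_fun (setT : set mZ) f.
Proof.
elim => {f}.
- apply: measurable_funM.
    by do 2 apply: measurableT_comp => //; exact: measurable_s_re.
  by apply: measurableT_comp measurable_s_im; apply: continuous_measurable_fun;
    exact: continuous_cos.
- apply: measurableT_comp => //; apply: measurable_funM.
    by do 2 apply: measurableT_comp => //; exact: measurable_s_re.
  by apply: measurableT_comp measurable_s_im; apply: continuous_measurable_fun;
    exact: continuous_sin.
- by move=> f g _ mf _ mg; exact: measurable_funD.
- by move=> f g /moderate_measurable mf _ mg; exact: measurable_funM.
Qed.

End rapid_decay.

(** * Holomorphic functions of w and the Grushin operator *)

Section solution.
Context (R : realType) (n : nat).
Local Notation Z := (xtspace R n).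
Implicit Types (A B f g : Z -> R) (F : Z -> R[i]) (z : Z) (d : option 'I_n).

Definition cplx A B : Z -> R[i] := fun z => (A z +i* B z)%C.

Lemma cplx_eta F : F = cplx (cRe F) (cIm F).
Proof. by apply/funext => z; rewrite /cplx /cRe /cIm; case: (F z). Qed.

Lemma partial_cplx A B dA dB d : has_partials A dA -> has_partials B dB ->
  partial d (cplx A B) = cplx (dA d) (dB d).
Proof.
by move=> HA HB; apply/funext => z; rewrite /partial /cplx; congr Complex;
  [have [_ ->] := HA z|have [_ ->] := HB z].
Qed.

Definition crapid F := rapid (cRe F) /\ rapid (cIm F).

Lemma crapid_partial d F : crapid F -> crapid (partial d F).
Proof.
rewrite (cplx_eta F) => -[/rapid_partials[dA HA rA] /rapid_partials[dB HB rB]].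
rewrite (partial_cplx d HA HB); split; [exact: rA|exact: rB].
Qed.

Lemma crapid_iter_partial ds F : crapid F -> crapid (iter_partial ds F).
Proof. by move=> rF; elim: ds => [//|d ds IH] /=; exact: crapid_partial. Qed.

Lemma rapid_differentiable f z : rapid f -> differentiable f z.
Proof. by move=> /rapid_partials[df Hf _]; have [] := Hf z. Qed.

Lemma crapid_smooth F : crapid F -> smooth F.
Proof.
move=> rF ds z; have [rr ri] := crapid_iter_partial ds rF.
by split; exact: rapid_differentiable.
Qed.

Lemma sqrt_sqmod_le F z : Num.sqrt (sqmod F z) <= `|cRe F z| + `|cIm F z|.
Proof.
rewrite -(@ler_pXn2r _ 2)// ?nnegrE ?sqrtr_ge0 ?addr_ge0//.
rewrite sqr_sqrtr ?addr_ge0 ?sqr_ge0// /sqmod.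
rewrite -(real_normK (num_real (cRe F z))) -(real_normK (num_real (cIm F z))).
by have := normr_ge0 (cRe F z); have := normr_ge0 (cIm F z); nra.
Qed.

Lemma crapid_schwartz F : crapid F -> schwartz F.
Proof.
move=> rF; split; first exact: crapid_smooth.
move=> ds N; have [/rapid_le/(_ N)[C HC] /rapid_le/(_ N)[D HD]] := crapid_iter_partial ds rF.
exists (2 ^+ N * (C + D)) => z; set G := iter_partial ds F in HC HD *.
apply: le_trans (ler_wpM2l (exprn_ge0 _ _) (sqrt_sqmod_le G z)) _.
  by rewrite addr_ge0.
apply: le_trans (_ : (2 * w_abs z) ^+ N * (`|cRe G z| + `|cIm G z|) <= _).
  rewrite ler_wpM2r ?addr_ge0// lerXn2r ?nnegrE ?norm_le_w_abs ?addr_ge0//.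
  by rewrite mulr_ge0// (ltW (w_abs_gt0 z)).
rewrite exprMn -mulrA ler_wpM2l ?exprn_ge0// mulrDr.
by apply: lerD.
Qed.

(* Holomorphic functions of [w]: [d (A + i B) = (X + i Y) dw]. *)
Definition holo A B X Y :=
  has_partials A (fun d z => dw_re d z * X z - dw_im d z * Y z) /\
  has_partials B (fun d z => dw_re d z * Y z + dw_im d z * X z).

Lemma holoM A B X Y A' B' X' Y' : holo A B X Y -> holo A' B' X' Y' ->
  holo (fun z => A z * A' z - B z * B' z) (fun z => A z * B' z + B z * A' z)
    (fun z => A z * X' z - B z * Y' z + (X z * A' z - Y z * B' z))
    (fun z => A z * Y' z + B z * X' z + (X z * B' z + Y z * A' z)).
Proof.
move=> [HA HB] [HA' HB']; split.
- apply: has_partials_ext (has_partialsD (has_partialsM HA HA')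
    (has_partialsM (has_partials_cst (-1)) (has_partialsM HB HB'))).
    by apply/funext => z; rewrite mulN1r.
  by move=> d z; ring.
- apply: has_partials_ext (has_partialsD (has_partialsM HA HB') (has_partialsM HB HA')) => //.
  by move=> d z; ring.
Qed.

(* [- 1 / (2 S)], the logarithmic derivative of [exp (- S)] in [w] *)
Definition dlog_re z : R := - s_re z * v_abs z / 2.
Definition dlog_im z : R := s_im z * v_abs z / 2.

Definition de_re z : R := dlog_re z * e_re z - dlog_im z * e_im z.
Definition de_im z : R := dlog_re z * e_im z + dlog_im z * e_re z.

Definition packet := cplx (@e_re R n) (@e_im R n).
Definition dpacket := cplx de_re de_im.

Lemma crapid_packet : crapid packet.
Proof. by split; [exact: rapid_re|exact: rapid_im]. Qed.

Lemma crapid_dpacket : crapid dpacket.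
Proof.
have mr : moderate dlog_re.
  apply: (@moderate_ext _ _ _ (fun z => (-1) * s_re z * v_abs z * 2^-1)).
    by move=> z; rewrite mulN1r.
  by do 3?[apply: moderateM];
    first [exact: moderate_cst|exact: moderate_re|exact: moderate_im|exact: moderate_v].
have mi : moderate dlog_im
  by rewrite /dlog_im; do 2?[apply: moderateM];
    first [exact: moderate_cst|exact: moderate_re|exact: moderate_im|exact: moderate_v].
have mNi : moderate (fun z => (-1) * dlog_im z) by apply: moderateM => //;
  exact: moderate_cst.
split.
  apply: (@rapid_ext _ _ _ (fun z => dlog_re z * e_re z + ((-1) * dlog_im z) * e_im z)).
    by move=> z; rewrite /cRe /= /de_re; ring.
  by apply: rapidD; apply: rapidM => //; constructor.
by apply: rapidD; apply: rapidM => //; constructor.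
Qed.

Lemma holo_packet : holo (@e_re R n) (@e_im R n) de_re de_im.
Proof.
split.
- apply: has_partials_ext (@partials_e_re R n) => // d z.
  rewrite /ds_re /ds_im /de_re /de_im /dlog_re /dlog_im /v_abs; field.
  by rewrite gt_eqF// w_abs_gt0.
- apply: has_partials_ext (@partials_e_im R n) => // d z.
  rewrite /ds_re /ds_im /de_re /de_im /dlog_re /dlog_im /v_abs; field.
  by rewrite gt_eqF// w_abs_gt0.
Qed.

Lemma holo_dlog : exists X Y, holo dlog_re dlog_im X Y.
Proof.
(* The derivative of - 1 / (2 S) in w is 1 / (4 S^3), which equals conj (S w) / (4 |w|^3). *)
exists (fun z => v_abs z ^+ 3 * (s_re z * w_re z - s_im z * w_im z) / 4).
exists (fun z => - (v_abs z ^+ 3 * (s_re z * w_im z + s_im z * w_re z)) / 4).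
split.
- apply: has_partials_ext (has_partialsM (has_partials_cst (- 2^-1))
    (has_partialsM (@partials_s_re R n) (@partials_v_abs R n))).
    by apply/funext => z; rewrite /dlog_re; field.
  move=> d z; rewrite /ds_re /v_abs -(s_sqr_re z) -(s_sqr_im z) -(s_abs z).
  by field; rewrite s_abs gt_eqF// w_abs_gt0.
- apply: has_partials_ext (has_partialsM (has_partials_cst (2^-1))
    (has_partialsM (@partials_s_im R n) (@partials_v_abs R n))).
    by apply/funext => z; rewrite /dlog_im; field.
  move=> d z; rewrite /ds_im /v_abs -(s_sqr_re z) -(s_sqr_im z) -(s_abs z).
  by field; rewrite s_abs gt_eqF// w_abs_gt0.
Qed.

Lemma holo_dpacket : exists X Y, holo de_re de_im X Y.
Proof.
have [X [Y HT]] := holo_dlog.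
by do 2 eexists; exact: holoM HT holo_packet.
Qed.

Lemma sum_Complex (I : finType) (a b : I -> R) :
  \sum_j (a j +i* b j)%C = ((\sum_j a j) +i* (\sum_j b j))%C.
Proof. by elim/big_rec3 : _ => //= j x y _ _ ->. Qed.

Lemma enorm_sqr (x : 'rV[R]_n) : enorm x ^+ 2 = \sum_j x ord0 j ^+ 2.
Proof. by rewrite sqr_sqrtr// sumr_ge0// => j _; exact: sqr_ge0. Qed.

(* The terms in the second derivative cancel since
   [sum_j (d_j w)^2 = |x|^2 = - |x|^2 (d_t w)^2]. *)
Lemma grushin_packet : grushin packet = fun z => - (n%:R : R)%:C%C * dpacket z.
Proof.
have [X [Y [HA1 HB1]]] := holo_dpacket; have [HA HB] := holo_packet.
have pj j : partial (Some j) packet =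
    cplx (fun z => xcoord j z * de_re z) (fun z => xcoord j z * de_im z).
  by rewrite (partial_cplx _ HA HB); apply/funext => z; rewrite /cplx /=;
    congr Complex; ring.
have pt : partial None packet = cplx (fun z => (-1) * de_im z) de_re.
  by rewrite (partial_cplx _ HA HB); apply/funext => z; rewrite /cplx /=;
    congr Complex; ring.
apply/funext => z; rewrite /grushin pt.
rewrite (partial_cplx _ (has_partialsM (has_partials_cst (-1)) HB1) HA1).
rewrite (eq_bigr (fun j => ((de_re z + xcoord j z ^+ 2 * X z) +i*
    (de_im z + xcoord j z ^+ 2 * Y z))%C)); last first.
  move=> j _; have Hx := @has_partials_xcoord R n j.
  rewrite pj (partial_cplx _ (has_partialsM Hx HA1) (has_partialsM Hx HB1)).
  by rewrite /cplx /= eqxx; congr Complex; rewrite mulr1; ring.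
rewrite sum_Complex.
pose q : R := \sum_j xcoord j z ^+ 2.
have sumE (a b : R) : \sum_(j < n) (a + xcoord j z ^+ 2 * b) = n%:R * a + q * b.
  by rewrite big_split /= sumr_const card_ord mulr_suml mulr_natl.
have eq : enorm z.1 ^+ 2 = q by exact: enorm_sqr.
rewrite !sumE eq /dpacket /cplx /dw_re /dw_im.
move: (de_re z) (de_im z) (X z) (Y z) q {sumE eq} => a b x y q /=.
by congr Complex; ring.
Qed.

Definition translate (tau : R) z : Z := (z.1, z.2 + tau).

Lemma derive_translate f tau d z :
  'D_(axis R d) (f \o translate tau) z = 'D_(axis R d) f (translate tau z).
Proof.
have tr h : translate tau (h *: axis R d + z) = h *: axis R d + translate tau z.
  by rewrite /translate /=; congr pair; rewrite addrA.
rewrite /derive /=.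
by under eq_fun do rewrite tr.
Qed.

Lemma partial_translate F tau d :
  partial d (F \o translate tau) = partial d F \o translate tau.
Proof.
apply/funext => z; rewrite /partial /=; congr Complex; exact: derive_translate.
Qed.

Lemma iter_partial_translate F tau ds :
  iter_partial ds (F \o translate tau) = iter_partial ds F \o translate tau.
Proof. by elim: ds => [//|d ds IH] /=; rewrite IH partial_translate. Qed.

End solution.

(** * Integrability and time derivatives *)

Section integrable_bell.
Context (R : realType).
Local Notation leb := (@lebesgue_measure R).
Local Open Scope ereal_scope.

(** The Cauchy density up to the factor pi. Products over the coordinates are integrable by Tonelli
    and bounded below by a power of 1 / |w|. *)
Definition bell (y : R) : R := ((1 + y ^+ 2)^-1)%R.

Lemma bell_ge0 y : (0 <= bell y)%R.
Proof. by rewrite invr_ge0 addr_ge0// sqr_ge0. Qed.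

Lemma bell_le1 y : (bell y <= 1)%R.
Proof. by rewrite invf_le1 ?lerDl ?sqr_ge0// ltr_pwDl ?sqr_ge0. Qed.

Lemma bell_cont : continuous bell.
Proof. exact: continuous_oneDsqrV. Qed.

Lemma measurable_bell : measurable_fun (setT : set (measurableTypeR R)) bell.
Proof. by apply: continuous_measurable_fun; exact: bell_cont. Qed.

Lemma integral_bell_fin : \int[leb]_y (bell y)%:E < +oo.
Proof.
rewrite ge0_symfun_integralT.
- rewrite [X in _ * X](_ : _ = (pi / 2)%:E); first by rewrite ltry.
  by rewrite -integral0y_oneDsqr set_itvcy.
- exact: bell_ge0.
- exact: bell_cont.
- by move=> y; rewrite /bell /= sqrrN.
Qed.

Definition bells n (x : 'rV[R]_n) : R := (\prod_(j < n) bell (x ord0 j))%R.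

Lemma bells_ge0 n (x : 'rV[R]_n) : (0 <= bells x)%R.
Proof. by apply: prodr_ge0 => j _; exact: bell_ge0. Qed.

Lemma bells_le1 n (x : 'rV[R]_n) : (bells x <= 1)%R.
Proof.
have /andP[] // : (0 <= bells x <= 1)%R.
apply: (big_ind (fun y : R => 0 <= y <= 1)%R) => [|a b|j _].
- by rewrite ler01 lexx.
- by move=> /andP[a0 a1] /andP[b0 b1]; rewrite mulr_ge0//= mulr_ile1.
- by rewrite bell_ge0 bell_le1.
Qed.

Lemma measurable_bells n : measurable_fun (setT : set 'rV[R]_n) (@bells n).
Proof.
apply: measurable_prod => j _.
exact: measurableT_comp measurable_bell (measurable_coord j).
Qed.

Lemma measurable_cons n : measurable_fun (setT : set (measurableTypeR R * 'rV[R]_n))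
  (fun p : R * 'rV[R]_n => (\row_i if unlift ord0 i is Some j then p.2 ord0 j else p.1)%R).
Proof.
apply/measurable_fun_rVP => i.
under eq_fun do rewrite mxE.
case: unliftP => [j _|_]; last exact: measurable_fst.
exact: (measurableT_comp (measurable_coord j) measurable_snd).
Qed.

(** One step of the recursion behind [lebesgue_rV]: the measure is the pushforward of a product,
    which gives Tonelli access to the first coordinate. *)
Lemma integral_lebesgue_rVS n (f : 'rV[R]_n.+1 -> \bar R) :
  measurable_fun setT f -> (forall x, 0 <= f x) ->
  \int[lebesgue_rV R n.+1]_x f x = \int[(leb \x lebesgue_rV R n)]_p
    f (\row_i if unlift ord0 i is Some j then p.2 ord0 j else p.1)%R.
Proof.
move=> mf f0.
have := @ge0_integral_pushforward _ _ _ _ R _ (@measurable_cons n)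
  [the {measure set _ -> \bar R} of (leb \x lebesgue_rV R n)] setT f measurableT mf
  (fun y _ => f0 y).
by rewrite preimage_setT.
Qed.

Lemma integral_bells_fin n : \int[lebesgue_rV R n]_x (bells x)%:E < +oo.
Proof.
elim: n => [|n IH].
  rewrite (eq_integral (fun=> 1%:E)); last by move=> x _; rewrite /bells big_ord0.
  by rewrite integral_cst// mul1e /= diracT ltry.
have mb k : measurable_fun setT (fun x : 'rV[R]_k => (bells x)%:E).
  by apply/measurable_EFinP; exact: measurable_bells.
rewrite integral_lebesgue_rVS//; last by move=> x; rewrite lee_fin bells_ge0.
rewrite (eq_integral (fun p : measurableTypeR R * 'rV[R]_n => (bell p.1 * bells p.2)%:E)); last first.
  move=> p _; congr EFin; rewrite /bells big_ord_recl mxE unlift_none; congr (_ * _)%R.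
  by apply: eq_bigr => j _; rewrite mxE liftK.
rewrite fubini_tonelli1; last 2 first.
- apply/measurable_EFinP; apply: measurable_funM.
    by apply: (measurableT_comp measurable_bell); exact: measurable_fst.
  by apply: (measurableT_comp (@measurable_bells n)); exact: measurable_snd.
- by move=> p; rewrite lee_fin mulr_ge0 ?bell_ge0 ?bells_ge0.
rewrite /fubini_F (eq_integral (fun x : measurableTypeR R =>
  (bell x)%:E * \int[lebesgue_rV R n]_y (bells y)%:E)).
  rewrite ge0_integralZr//.
  - rewrite lte_mul_pinfty ?integral_bell_fin//.
      by apply: integral_ge0 => y _; rewrite lee_fin bell_ge0.
    rewrite ge0_fin_numE ?integral_bell_fin//.
    by apply: integral_ge0 => y _; rewrite lee_fin bell_ge0.
  - by apply/measurable_EFinP; exact: measurable_bell.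
  - by move=> y _; rewrite lee_fin bell_ge0.
  - by apply: integral_ge0 => y _; rewrite lee_fin bells_ge0.
move=> x _ /=; under eq_integral do rewrite EFinM.
rewrite ge0_integralZl//.
- exact: mb.
- by move=> y _; rewrite lee_fin bells_ge0.
- by rewrite lee_fin bell_ge0.
Qed.

Definition bell_xt n (z : xtspace R n) : R := (bells z.1 * bell z.2)%R.

Lemma bell_xt_ge0 n (z : xtspace R n) : (0 <= bell_xt z)%R.
Proof. by rewrite mulr_ge0 ?bells_ge0 ?bell_ge0. Qed.

Lemma bell_xt_le1 n (z : xtspace R n) : (bell_xt z <= 1)%R.
Proof. by rewrite mulr_ile1 ?bells_ge0 ?bell_ge0 ?bells_le1 ?bell_le1. Qed.

Lemma measurable_bell_xt n :
  measurable_fun (setT : set ('rV[R]_n * measurableTypeR R)) (@bell_xt n).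
Proof.
apply: measurable_funM.
  by apply: (measurableT_comp (@measurable_bells n)); exact: measurable_fst.
by apply: (measurableT_comp measurable_bell); exact: measurable_snd.
Qed.

Lemma integral_bell_xt_fin n : \int[lebesgue_xt R n]_z (bell_xt z)%:E < +oo.
Proof.
have mb : measurable_fun setT (fun x : 'rV[R]_n => (bells x)%:E).
  by apply/measurable_EFinP; exact: measurable_bells.
rewrite [X in X < _](fubini_tonelli1 (m1 := lebesgue_rV R n) (m2 := leb)); last 2 first.
- by apply/measurable_EFinP; exact: measurable_bell_xt.
- by move=> p; rewrite lee_fin bell_xt_ge0.
rewrite /fubini_F (eq_integral (fun x => (bells x)%:E * \int[leb]_y (bell y)%:E)).
  rewrite ge0_integralZr//.
  - rewrite lte_mul_pinfty ?integral_bell_fin//.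
      by apply: integral_ge0 => y _; rewrite lee_fin bells_ge0.
    rewrite ge0_fin_numE ?integral_bells_fin//.
    by apply: integral_ge0 => y _; rewrite lee_fin bells_ge0.
  - by move=> y _; rewrite lee_fin bells_ge0.
  - by apply: integral_ge0 => y _; rewrite lee_fin bell_ge0.
move=> x _; under eq_integral do rewrite /bell_xt EFinM /=.
rewrite ge0_integralZl//.
- by apply/measurable_EFinP; exact: measurable_bell.
- by move=> y _; rewrite lee_fin bell_ge0.
- by rewrite lee_fin bells_ge0.
Qed.

End integrable_bell.

(** * Domination of translates and differentiation under the integral *)

Section translated_packet.
Context (R : realType) (n : nat).
Local Notation Z := (xtspace R n).
Local Notation mZ := ('rV[R]_n * measurableTypeR R)%type.
Local Notation mu := (lebesgue_xt R n).
Local Notation rL2 := (@rL2 _ mZ R mu).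
Local Notation dot := (@dot _ mZ R mu).
Implicit Types (f b : Z -> R) (F : Z -> R[i]) (z : Z).

Lemma translate_differentiable tau z : differentiable (translate tau) z.
Proof.
rewrite (_ : translate tau = id + cst (0, tau)).
  by apply: differentiableD; [exact: ex_diff|exact: differentiable_cst].
by apply/funext => -[x t]; rewrite /translate /= !fctE; congr pair; rewrite addr0.
Qed.

Lemma smooth_translate F tau : crapid F -> smooth (F \o translate tau).
Proof.
move=> rF ds z; rewrite iter_partial_translate.
have [dr di] := crapid_smooth rF ds (translate tau z).
have dt := translate_differentiable tau z.
by split; [exact: (differentiable_comp dt dr)|exact: (differentiable_comp dt di)].
Qed.

(** A translation changes the Schwartz weights only by a constant factor. *)
Lemma norm_translate tau z : 1 + `|z| <= (1 + `|tau|) * (1 + `|translate tau z|).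
Proof.
have zE : z = translate tau z - (0, tau).
  by case: z => x t; rewrite /translate /=; congr pair; rewrite ?subr0 ?addrK.
have : `|z| <= `|translate tau z| + `|tau|.
  rewrite {1}zE; apply: le_trans (ler_normB _ _) _; rewrite lerD2l.
  by rewrite prod_normE /= normr0 max_r.
by have := normr_ge0 tau; have := normr_ge0 (translate tau z); nra.
Qed.

Lemma schwartz_translate F tau : crapid F -> schwartz (F \o translate tau).
Proof.
move=> rF; split; first exact: smooth_translate.
move=> ds N; have [_ /(_ ds N)[C HC]] := crapid_schwartz rF.
exists ((1 + `|tau|) ^+ N * C) => z; rewrite iter_partial_translate.
rewrite -[sqmod _ z]/(sqmod (iter_partial ds F) (translate tau z)).
apply: le_trans (ler_wpM2l _ (HC (translate tau z)));
  last by rewrite exprn_ge0// addr_ge0.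
rewrite mulrA -exprMn ler_wpM2r ?sqrtr_ge0//.
by rewrite lerXn2r ?nnegrE ?norm_translate ?mulr_ge0 ?addr_ge0.
Qed.

Lemma bell_ge z (y : R) : `|y| <= w_abs z -> (2 * w_abs z ^+ 2)^-1 <= bell y.
Proof.
move=> yz; have w1 := w_abs_ge1 z; have y0 := normr_ge0 y.
rewrite /bell lef_pV2 ?posrE.
- by rewrite -(real_normK (num_real y)); nra.
- by have := sqr_ge0 y; nra.
- by nra.
Qed.

(** Each of the n + 1 factors of [bell_xt] is at least 1 / (2 |w|^2), so decay of order 2 (n + 1) in
    |w| suffices. *)
Lemma rapid_bell f : rapid f -> exists2 C, 0 <= C & forall z, `|f z| <= C * bell_xt z.
Proof.
move=> /rapid_le/(_ (2 * n.+1)%N)[C HC]; exists (`|C| * 2 ^+ n.+1);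
  first by rewrite mulr_ge0.
move=> z; have w0 := w_abs_gt0 z.
pose e := (2 * w_abs z ^+ 2)^-1.
have e0 : 0 < e by rewrite invr_gt0 mulr_gt0// exprn_gt0.
have eb : e ^+ n.+1 <= bell_xt z.
  rewrite exprSr /bell_xt ler_pM ?exprn_ge0 ?(ltW e0)//.
    rewrite /bells -[X in e ^+ X]card_ord -prodr_const ler_prod// => j _.
    by rewrite (ltW e0) bell_ge// xcoord_le.
  by rewrite bell_ge// tcoord_le.
rewrite -mulrA; apply: le_trans (_ : `|C| * (2 ^+ n.+1 * e ^+ n.+1) <= _); last first.
  by rewrite !ler_wpM2l.
rewrite -exprMn /e invfM mulrA mulfV// mul1r exprVn -exprM.
by rewrite ler_pdivlMr ?exprn_gt0// mulrC (le_trans (HC z))// ler_norm.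
Qed.

(** Peetre's inequality 1 + t^2 <= 2 (1 + tau^2) (1 + (t + tau)^2); the difference of the two sides
    is 1 + (t + 2 tau)^2 + 2 tau^2 (t + tau)^2. *)
Lemma bell_xt_translate tau z :
  bell_xt (translate tau z) <= 2 * (1 + tau ^+ 2) * bell_xt z.
Proof.
rewrite /bell_xt /= mulrCA ler_wpM2l ?bells_ge0// /bell.
have a0 : 0 < 1 + (z.2 + tau) ^+ 2 by rewrite ltr_pwDl ?sqr_ge0.
have b0 : 0 < 1 + z.2 ^+ 2 by rewrite ltr_pwDl ?sqr_ge0.
rewrite ler_pdivlMr// mulrC ler_pdivrMr//.
have := sqr_ge0 (z.2 + 2 * tau); have := sqr_ge0 (tau * (z.2 + tau)).
nra.
Qed.

(** One majorant for all shifts up to T: it serves to differentiate under the integral and to bound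
    the norm of u_s uniformly. *)
Lemma rapid_bell_translate f : rapid f ->
  exists2 C, 0 <= C & forall T tau z, `|tau| <= T ->
    `|f (translate tau z)| <= C * (1 + T ^+ 2) * bell_xt z.
Proof.
move=> /rapid_bell[C C0 HC]; exists (2 * C); first by rewrite mulr_ge0.
move=> T tau z tauT; apply: le_trans (HC _) _.
apply: le_trans (ler_wpM2l C0 (bell_xt_translate tau z)) _.
rewrite mulrA ler_wpM2r ?bell_xt_ge0// mulrA (mulrC C) ler_wpM2l ?mulr_ge0//.
rewrite lerD2l -real_normK ?num_real// ler_pXn2r ?nnegrE//.
exact: le_trans tauT.
Qed.

Lemma rL2_bell_xt : rL2 (@bell_xt R n).
Proof.
have mb := @measurable_bell_xt R n.
split; first exact: mb.
apply: le_lt_trans (@integral_bell_xt_fin R n); apply: ge0_le_integral => //.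
- by move=> z _; rewrite lee_fin sqr_ge0.
- by apply/measurable_EFinP; exact: measurable_funX.
- exact/measurable_EFinP.
- move=> z _; rewrite lee_fin expr2 ler_piMr ?bell_xt_le1//; exact: bell_xt_ge0.
Qed.

Lemma measurable_translate (tau : R) :
  measurable_fun (setT : set mZ) (translate tau : mZ -> mZ).
Proof.
apply/measurable_fun_pairP; split; first exact: measurable_fst.
by apply: measurable_funD => //; exact: measurable_snd.
Qed.

Lemma rL2_translate f tau : rapid f -> rL2 (f \o translate tau).
Proof.
move=> rf; have [C C0 HC] := rapid_bell_translate rf.
apply: (@rL2_le _ mZ R mu _ (fun z => C * (1 + `|tau| ^+ 2) * bell_xt z)).
- exact: measurableT_comp (rapid_measurable rf) (measurable_translate tau).
- by move=> z; exact: HC.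
- by apply: rL2Z; exact: rL2_bell_xt.
Qed.

Lemma crapid_L2 F tau : crapid F -> L2 (F \o translate tau).
Proof. by move=> [rr ri]; apply/L2P; split;
  [exact: (rL2_translate tau rr)|exact: (rL2_translate tau ri)]. Qed.

Lemma dot_le (a b : Z -> R) : rL2 a -> rL2 b -> (forall z, `|a z| <= b z) ->
  dot a a <= dot b b.
Proof.
move=> La Lb ab; apply: le_Rintegral => //; try exact: rL2_integrableM.
move=> z _; rewrite -!expr2 -real_normK ?num_real//.
by rewrite ler_pXn2r ?nnegrE// (le_trans _ (ab z)).
Qed.

Lemma is_derive_translate f df z (tau : R) : has_partials f df ->
  is_derive tau 1 (fun r : R => f (translate r z)) (df None (translate tau z)).
Proof.
move=> Hf; have [Df Pf] := Hf (translate tau z).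
have H : is_derive (translate tau z) (axis R None) f (df None (translate tau z)).
  by apply: DeriveDef; [exact: diff_derivable|exact: Pf].
have tr (h : R) : translate (h *: 1 + tau) z = h *: axis R None + translate tau z.
  rewrite /translate /axis /=; congr pair.
    by rewrite -[RHS]/(h *: 0 + z.1) scaler0 add0r.
  by rewrite -[RHS]/(h *: 1 + (z.2 + tau)) addrCA.
have E : (fun h : R => h^-1 *: (((fun r : R => f (translate r z)) \o shift tau) (h *: 1)
      - f (translate tau z))) =
    (fun h : R => h^-1 *: ((f \o shift (translate tau z)) (h *: axis R None)
      - f (translate tau z))).
  by apply/funext => h /=; rewrite tr.
case: H => D1 D2; apply: DeriveDef.
  by rewrite /derivable E.
by rewrite /derive E.
Qed.

Lemma is_derive_translateM f df z (c s : R) : has_partials f df ->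
  is_derive s 1 (fun r : R => f (translate (r * c) z)) (c * df None (translate (s * c) z)).
Proof.
move=> Hf.
have dS : is_derive s 1 (fun r : R => r * c) c.
  by apply: is_derive_eq; rewrite /GRing.scale /=; ring.
have H : is_derive s 1 ((fun r => f (translate r z)) \o (fun r : R => r * c))
    (df None (translate (s * c) z) * c).
  by apply: is_derive1_comp => //; exact: is_derive_translate.
by apply: is_derive_eq H _; rewrite mulrC.
Qed.

Lemma is_derive_dot f df b (c s : R) : rapid f -> has_partials f df ->
  (forall d, rapid (df d)) -> rL2 b ->
  is_derive s 1 (fun r : R => dot (f \o translate (r * c)) b)
    (c * dot (df None \o translate (s * c)) b).
Proof.
move=> rf Hf rdf Lb.
have [C C0 HC] := rapid_bell_translate (rdf None).
(* [T] bounds every shift r * c with r in the interval of radius 1 around s. The majorant below is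
   integrable as a product of two L^2 functions. *)
pose T := (`|s| + 1) * `|c|.
pose k := `|c| * (C * (1 + T ^+ 2)).
have k0 : 0 <= k by rewrite !mulr_ge0// addr_ge0// sqr_ge0.
pose phi (r : R) (z : mZ) := f (translate (r * c) z) * b z.
have Ib : mu.-integrable setT (EFin \o (fun z => bell_xt z * `|b z|)).
  rewrite (_ : EFin \o _ = abse \o (EFin \o (fun z => bell_xt z * b z))).
    by apply: integrable_abse; apply: rL2_integrableM => //; exact: rL2_bell_xt.
  by apply/funext => z /=; rewrite normrM (ger0_norm (bell_xt_ge0 z)).
have IG : mu.-integrable setT (EFin \o (fun z => k * (bell_xt z * `|b z|))).
  by apply: (@integrableZl _ _ _ mu setT measurableT k _ Ib).
have dphi (r : R) z : is_derive r 1 (phi ^~ z) (c * df None (translate (r * c) z) * b z).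
  rewrite (_ : phi ^~ z = (fun r : R => f (translate (r * c) z)) * cst (b z))//.
  have H := is_derive_translateM z c r Hf.
  by apply: is_derive_eq; rewrite /GRing.scale /= mulr0 add0r mulrC.
have sI : s \in `]s - 1, s + 1[ by rewrite in_itv /= ltrDl ltrBlDr ltrDl ltr01.
have intphi (r : R) : `]s - 1, s + 1[%classic r -> mu.-integrable setT (EFin \o phi r).
  by move=> _; apply: rL2_integrableM => //; exact: rL2_translate.
have derphi (r : R) z : `]s - 1, s + 1[%classic r -> setT z -> derivable (phi ^~ z) r 1.
  by move=> _ _; have [] := dphi r z.
have G0 z : 0 <= k * (bell_xt z * `|b z|)
  by apply: mulr_ge0 => //; apply: mulr_ge0 => //; exact: bell_xt_ge0.
have Gub (r : R) z : `]s - 1, s + 1[%classic r -> setT z ->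
    `|partial1of2 phi r z| <= k * (bell_xt z * `|b z|).
  rewrite /= in_itv /= => /andP[r1 r2] _; rewrite partial1of2E.
  have [_ ->] := dphi r z.
  rewrite !normrM /k -!mulrA ler_wpM2l//.
  rewrite [leRHS](_ : _ = C * (1 + T ^+ 2) * bell_xt z * `|b z|);
    last by rewrite !mulrA.
  rewrite ler_wpM2r//; apply: HC; rewrite normrM ler_wpM2r//.
  have := ler_norm s; have := ler_norm (- s); rewrite normrN => *.
  by rewrite ler_norml; apply/andP; split; lra.
have D := derivable_under_integral measurableT sI intphi derphi G0 IG Gub.
have V := differentiation_under_integral measurableT sI intphi derphi G0 IG Gub.
apply: DeriveDef; first exact: D.
rewrite -derive1E [LHS]V /dot -RintegralZl//; last first.
  by apply: rL2_integrableM => //; exact: rL2_translate.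
apply: eq_Rintegral => z _; rewrite partial1of2E.
by have [_ ->] := dphi s z; rewrite mulrA.
Qed.

End translated_packet.

(** * The translated packets solve the equation *)

Section packet_solves.
Context (R : realType) (n : nat).
Local Notation Z := (xtspace R n).
Local Notation mZ := ('rV[R]_n * measurableTypeR R)%type.
Local Notation mu := (lebesgue_xt R n).
Local Notation rL2 := (@rL2 _ mZ R mu).
Local Notation dot := (@dot _ mZ R mu).

Definition sol (s : R) : Z -> R[i] := @packet R n \o translate (s * n%:R).

(** The coefficient |x|^2 does not involve t, so translations in t commute with the operator. *)
Lemma grushin_translate (F : Z -> R[i]) tau :
  grushin (F \o translate tau) = grushin F \o translate tau.
Proof.
apply/funext => z.
have P d : partial d (partial d (F \o translate tau)) z =
    partial d (partial d F) (translate tau z).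
  by rewrite !partial_translate.
have H : \sum_j partial (Some j) (partial (Some j) (F \o translate tau)) z =
    \sum_j partial (Some j) (partial (Some j) F) (translate tau z).
  by apply: eq_bigr => j _; exact: P.
exact: (f_equal2 (fun a b => - a - ((enorm z.1 ^+ 2)%:C)%C * b) H (P None)).
Qed.

Lemma grushin_sol s : grushin (sol s) =
  (fun z => - (n%:R : R)%:C%C * @dpacket R n z) \o translate (s * n%:R).
Proof.
by rewrite grushin_translate grushin_packet.
Qed.

Lemma cRe_grushin_sol s : cRe (grushin (sol s)) =
  (fun z => - n%:R * @de_re R n z) \o translate (s * n%:R).
Proof.
by rewrite grushin_sol; apply/funext => z; rewrite /cRe /=; ring.
Qed.

Lemma cIm_grushin_sol s : cIm (grushin (sol s)) =
  (fun z => - n%:R * @de_im R n z) \o translate (s * n%:R).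
Proof.
by rewrite grushin_sol; apply/funext => z; rewrite /cIm /=; ring.
Qed.

Lemma L2_sol s : L2 (sol s).
Proof. exact: crapid_L2 (@crapid_packet R n). Qed.

Lemma L2_grushin_sol s : L2 (grushin (sol s)).
Proof.
have [rr ri] := @crapid_dpacket R n.
apply/L2P; rewrite cRe_grushin_sol cIm_grushin_sol.
by split; apply: rL2_translate; apply: rapidM => //; exact: moderate_cst.
Qed.

Lemma sqnorm0 : sqnorm ((fun=> 0) : Z -> R[i]) = 0%E.
Proof.
rewrite /sqnorm integral0_eq// => z _.
by rewrite /sqmod /cRe /cIm /= expr0n addr0.
Qed.

Lemma grushin_operator_sol s : grushin_operator (sol s) (grushin (sol s)).
Proof.
split; [exact: L2_sol|exact: L2_grushin_sol|].
(* The function is itself Schwartz, so a constant sequence places it in the closure. *)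
exists (fun=> sol s); split.
- by move=> _; exact: schwartz_translate (@crapid_packet R n).
- under eq_fun do under [X in sqnorm X]eq_fun do rewrite subrr.
  by rewrite sqnorm0; exact: cvg_cst.
- under eq_fun do under [X in sqnorm X]eq_fun do rewrite subrr.
  by rewrite sqnorm0; exact: cvg_cst.
Qed.

Lemma is_derive_dot_re (s : R) b : rL2 b -> is_derive s 1 (fun r : R => dot (cRe (sol r)) b)
  (dot (cIm (grushin (sol s))) b).
Proof.
move=> Lb; have [Hr _] := @holo_packet R n.
have [rr ri] := @crapid_dpacket R n.
(* The sign is written as a factor -1 because [rapid] is generated by sums and moderate
   multiples. *)
have Hr' : has_partials (@e_re R n) (fun d z => dw_re d z * de_re z + (-1) * dw_im d z * de_im z).
  by apply: has_partials_ext Hr => // d z; ring.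
have rd d : rapid (fun z : Z => dw_re d z * de_re z + (-1) * dw_im d z * de_im z).
  apply: rapidD; apply: rapidM => //; first exact: moderate_dw_re.
  by apply: moderateM; [exact: moderate_cst|exact: moderate_dw_im].
apply: is_derive_eq (is_derive_dot n%:R s (@rapid_re R n) Hr' rd Lb) _.
rewrite -dotZl//; last exact: rL2_translate.
rewrite cIm_grushin_sol; congr (dot _ _); apply/funext => z /=; ring.
Qed.

Lemma is_derive_dot_im (s : R) b : rL2 b -> is_derive s 1 (fun r : R => dot (cIm (sol r)) b)
  (- dot (cRe (grushin (sol s))) b).
Proof.
move=> Lb; have [_ Hi] := @holo_packet R n.
have [rr ri] := @crapid_dpacket R n.
have rd d : rapid (fun z : Z => dw_re d z * de_im z + dw_im d z * de_re z).
  by apply: rapidD; apply: rapidM => //; [exact: moderate_dw_re|exact: moderate_dw_im].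
apply: is_derive_eq (is_derive_dot n%:R s (@rapid_im R n) Hi rd Lb) _.
have Lh : rL2 (cRe (grushin (sol s))) by have /L2P[] := L2_grushin_sol s.
rewrite -[RHS]mulN1r -!dotZl//; last exact: rL2_translate.
rewrite cRe_grushin_sol; congr (dot _ _); apply/funext => z /=; ring.
Qed.

Lemma inner_sol_le (S : R) : exists K, forall s, `|s| <= `|S| ->
  complex.Re (inner (sol s) (sol s)) <= K.
Proof.
have [C C0 HC] := rapid_bell_translate (@rapid_re R n).
have [D D0 HD] := rapid_bell_translate (@rapid_im R n).
pose T := `|S| * n%:R.
pose bC (z : Z) := C * (1 + T ^+ 2) * bell_xt z.
pose bD (z : Z) := D * (1 + T ^+ 2) * bell_xt z.
exists (dot bC bC + dot bD bD) => s sS.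
have sT : `|s * n%:R| <= T by rewrite normrM (ger0_norm (ler0n _ _)) ler_wpM2r.
have [Lr Li] := (L2P _).1 (L2_sol s).
rewrite innerE; [|exact: L2_sol|exact: L2_sol].
apply: lerD; apply: dot_le => //; try (by apply: rL2Z; exact: rL2_bell_xt).
- by move=> z; exact: HC.
- by move=> z; exact: HD.
Qed.

Lemma sol_exp_group (s : R) : exp_group (@grushin_operator R n) s (sol 0) (sol s).
Proof.
move=> E [pv AE].
have uh r : spectral_integral E (fun l => (l%:C)%C) (sol r) (grushin (sol r)).
  by apply/AE; exact: grushin_operator_sol.
split; [exact: expNi_domain (L2_sol 0)|exact: L2_sol|].
move=> g [Lg _]; have [K HK] := inner_sol_le s.
have [Lgr Lgi] := (L2P g).1 Lg.
apply: (inner_propagated pv uh _ _ HK Lg) => {g Lg Lgr Lgi} g r Lg;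
  have [Lgr Lgi] := (L2P g).1 Lg.
- rewrite (_ : (fun _ => _) = (fun r : R => dot (cRe (sol r)) (cRe g)) +
      (fun r : R => dot (cIm (sol r)) (cIm g))); last first.
    by apply/funext => x; rewrite innerE//; exact: L2_sol.
  rewrite innerE//; last exact: L2_grushin_sol.
  exact: is_deriveD (is_derive_dot_re _ _) (is_derive_dot_im _ _).
- rewrite (_ : (fun _ => _) = (fun r : R => dot (cIm (sol r)) (cRe g)) -
      (fun r : R => dot (cRe (sol r)) (cIm g))); last first.
    by apply/funext => x; rewrite innerE//; exact: L2_sol.
  rewrite innerE//=; last exact: L2_grushin_sol.
  rewrite opprD.
  exact: is_deriveB (is_derive_dot_im _ _) (is_derive_dot_re _ _).
Qed.

Lemma sol_pointwise (s : R) z :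
  [/\ derivable (fun r => cRe (sol r) z) s 1,
      derivable (fun r => cIm (sol r) z) s 1 &
      (0 +i* 1)%C * (derive1 (fun r => cRe (sol r) z) s +i*
                     derive1 (fun r => cIm (sol r) z) s)%C
        - grushin (sol s) z = 0].
Proof.
have [Hr Hi] := @holo_packet R n.
have [D1 V1] := is_derive_translateM z n%:R s Hr.
have [D2 V2] := is_derive_translateM z n%:R s Hi.
split; [exact: D1|exact: D2|].
have e1 : (fun r : R => cRe (sol r) z)^`()%classic s =
    n%:R * - de_im (translate (s * n%:R) z).
  by rewrite derive1E [LHS]V1 /dw_re /dw_im mul0r mul1r sub0r.
have e2 : (fun r : R => cIm (sol r) z)^`()%classic s =
    n%:R * de_re (translate (s * n%:R) z).
  by rewrite derive1E [LHS]V2 /dw_re /dw_im mul0r mul1r add0r.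
rewrite e1 e2 grushin_sol /= /dpacket /cplx.
move: (de_re _) (de_im _) => a b /=.
by congr Complex; ring.
Qed.

End packet_solves.

Theorem proposition1p1 (R : realType) (n : nat) (n_gt0 : (0 < n)%N) :
  exists f : xtspace R n -> R[i],
    [/\ schwartz f, f <> (fun=> 0) &
        exists2 u : R -> xtspace R n -> R[i], grushin_solution f u &
          forall (s : R) (x : 'rV[R]_n) (t : R),
            u s (x, t) = f (x, t + s * n%:R)].
Proof.
exists (@packet R n); split.
- exact: crapid_schwartz (@crapid_packet R n).
(* At the origin w = 1 is real, so the packet takes the value of a real exponential there. *)
- move=> /(congr1 (fun F => complex.Re (F (0, 0)))) /=; rewrite /e_re.
  rewrite (_ : s_im _ = 0) ?cos0 ?mulr1; last by rewrite /s_im /w_im /tcoord /= mul0r.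
  by move/eqP; rewrite gt_eqF// expR_gt0.
exists (@sol R n) => //.
have sol0 : @sol R n 0 = @packet R n.
  by apply/funext => -[x t]; rewrite /sol /translate /= mul0r addr0.
split => //.
- by move=> s; exact: smooth_translate (@crapid_packet R n).
- by move=> s; rewrite -sol0; exact: sol_exp_group.
- exact: sol_pointwise.
Qed.
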